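(* Let $0<a<b$, let $f$ be a Laplace-Stieltjes function and let $\mathcal M=I\otimes A-B^T\otimes I$, where $A,B\in\mathbb C^{n\times n}$ are such that $A$ and $-B$ are Hermitian positive definite with spectra contained in $[a,b]$. If $\mathrm{vec}(X)=f(\mathcal M)\,\mathrm{vec}(F)$ with $F=U_FV_F^T\in\mathbb C^{n\times n}$ of rank $k$, then for every $\ell\ge1$ $$\sigma_{1+\ell k}(X)\le 16\,\gamma_{\ell,\kappa}\,f(0^+)\,\rho_{[a,b]}^{\ell/2}\,\|F\|_2,$$ where $\kappa=b/a$ and $f(0^+):=\lim_{z\to0^+}f(z)$.
   Context: A function $f$ on $(0,\infty)$ is Laplace-Stieltjes if $f(z)=\int_0^\infty e^{-tz}\mu(t)\,dt$ for all $z>0$, where $\mu(t)\,dt$ is a non-negative measure on $[0,\infty)$ ($\mu$ may be a distribution such as a Dirac delta). The value $f(0^+)$ may be $+\infty$, in which case the bound is vacuous. $\sigma_1(X)\ge\sigma_2(X)\ge\dots$ are the singular values of $X$ (with $\sigma_j(X)=0$ for $j>n$); $\|\cdot\|_2$ is the spectral norm; $\mathrm{vec}$ stacks the columns of a matrix; $\otimes$ is the Kronecker product. Here $U_F,V_F\in\mathbb C^{n\times k}$. Constants: $\rho_{[a,b]}:=\exp\left(-\frac{\pi^2}{\log(4b/a)}\right)$ and $\gamma_{\ell,\kappa}:=2.23+\frac2\pi\log\left(4\ell\sqrt{\kappa/\pi}\right)$. *)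

(* Defs.v *)
From mathcomp Require Import all_boot all_order all_algebra.
From mathcomp Require Import spectral sesquilinear.
From mathcomp.real_closed Require Export complex mxtens.
From mathcomp Require Import all_classical all_reals all_analysis.

Set Implicit Arguments.
Unset Strict Implicit.
Unset Printing Implicit Defensive.

Import Order.TTheory GRing.Theory Num.Theory.
Import numFieldNormedType.Exports.
Local Open Scope complex_scope.
Local Open Scope classical_set_scope.
Local Open Scope ring_scope.
Local Open Scope sesquilinear_scope.

(* Only the values of [f] on (0, +oo) matter.  The measure on [0, +oo) is the
   restriction to [0, +oo) of a Borel measure on the line. *)
Definition laplace_stieltjes (R : realType) (f : R -> R) : Prop :=
  exists mu : {measure set (measurableTypeR R) -> \bar R},
    forall z : R, 0 < z ->
      (f z)%:E =
      (\int[mu]_(t in `[0%R, +oo[) (expR (- t * z))%:E)%E.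

(* f(0^+), possibly +oo. *)
Definition limit0p (R : realType) (f : R -> R) : \bar R :=
  lim ((f z)%:E @[z --> 0^'+]).

(* Column stacking: the entry (i, j) of [X] sits at position j * m + i of
   [vec X], the indexing for which vec (A *m X *m B) = (B^T *t A) *m vec X. *)
Definition vec (T : Type) (m n : nat) (X : 'M[T]_(m, n)) : 'cV[T]_(n * m) :=
  \col_p X (mxtens_unindex p).2 (mxtens_unindex p).1.

Definition posdefmx (R : realType) (n : nat) (A : 'M[R[i]]_n) : Prop :=
  A \is hermsymmx /\
  forall x : 'cV[R[i]]_n, x != 0 -> 0 < (x^t* *m A *m x) 0 0.

Definition spectrum_in (R : realType) (n : nat) (A : 'M[R[i]]_n) (a b : R) :=
  forall z : R[i], eigenvalue A z -> a%:C <= z <= b%:C.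

(* f(A) for Hermitian A = P^-1 diag(d) P (P unitary, d real), i.e.
   P^-1 diag(f(d)) P; it does not depend on the chosen diagonalization. *)
Definition mxfun (R : realType) (n : nat) (f : R -> R) (A : 'M[R[i]]_n) :
    'M[R[i]]_n :=
  let P := spectralmx A in
  invmx P *m diag_mx (map_mx (fun z => (f (complex.Re z))%:C) (spectral_diag A))
    *m P.

Definition singular_values (R : realType) (m n : nat) (X : 'M[R[i]]_(m, n)) :
    seq R :=
  sort >=%R [seq Num.sqrt (complex.Re (spectral_diag (X^t* *m X) 0 i))
            | i <- enum 'I_n].

(* Indexed from 1, and 0 past the number of columns. *)
Definition sigma (R : realType) (m n : nat) (j : nat) (X : 'M[R[i]]_(m, n)) :
    R :=
  nth 0 (singular_values X) j.-1.

Definition norm2v (R : realType) (n : nat) (x : 'cV[R[i]]_n) : R :=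
  Num.sqrt (\sum_i ComplexField.Normc.normc (x i 0) ^+ 2).

Definition norm2 (R : realType) (m n : nat) (X : 'M[R[i]]_(m, n)) : R :=
  sup [set norm2v (X *m x) | x in [set x : 'cV[R[i]]_n | norm2v x <= 1]].

Definition rho (R : realType) (a b : R) : R :=
  expR (- (pi ^+ 2 / ln (4 * b / a))).

Definition gammac (R : realType) (l : nat) (kappa : R) : R :=
  223 / 100 + 2 / pi * ln (4 * l%:R * Num.sqrt (kappa / pi)).

(* Main.v *)
Require Import Defs.
From mathcomp Require Import all_boot all_order all_algebra.
From mathcomp Require Import spectral sesquilinear ring lra.
From mathcomp.real_closed Require Import complex mxtens.
From mathcomp Require Import all_classical all_reals all_analysis.
From mathcomp Require Import measurable_realfun.

Set Implicit Arguments.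
Unset Strict Implicit.
Unset Printing Implicit Defensive.

Import Order.TTheory GRing.Theory Num.Theory.
Import numFieldNormedType.Exports.
Import ComplexField.Normc.
Local Open Scope complex_scope.
Local Open Scope ring_scope.

(** Write al_i and be_j for the eigenvalues of A and -B.  In unitary eigenbases
    of A and -B the function f of the Sylvester operator multiplies the (i, j)
    entry of F by f(al_i + be_j), the integral over t of
    e^{-t al_i} e^{-t be_j} dmu(t).  Suppose that every exponential e^{-tx},
    t >= 0, lies on [a, b] within T of a combination of l fixed functions
    p_0(x), ..., p_{l-1}(x), whose coefficients are finite combinations of
    exponentials in t.  If e^{-t al_i} is replaced by this combination, then F
    is multiplied by l products of diagonal matrices, which makes a matrix Y of
    rank at most l k ([low_rank_multiplier]); the remainder X - Y has norm at
    most T f(a) ||F|| ([multiplier_error_bound]), because the integral against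
    mu preserves inequalities between combinations of exponentials.  Then
    sigma_{1+lk}(X) <= T f(a) ||F|| ([sigma_le_of_low_rank]) and f(a) <= f(0+).

    It remains to reach T = 16 gamma rho^{l/2} ([laplace_kernel_approx]).  Put
    kappa = b/a, L = log(4 kappa) and X(s) = sum_m sech(s - 2 L m), which is up
    to scaling the Jacobi function dn.  This function is even and 2L-periodic,
    it has positive real part on the strip |Im s| < pi/2, and
    X(0) >= kappa X(L) ([sechr_sum_ratio]), so that x = c X(s) runs through
    [a, b] for a suitable c while s stays in [0, L].  On the strip
    |e^{-tcX}| <= 1, hence the n-th Fourier coefficient of e^{-tcX} is at most
    e^{-n pi eta/L} for all eta < pi/2, uniformly in t; for eta = pi/2 this
    would be rho^{n/2}.  The functions p_n(x) are the cosines cos(n pi s/L),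
    the tail of the cosine series is geometric, and the factor 16 gamma has
    room both for the sum of the tail and for an eta slightly below pi/2.

    The decay of the coefficients is obtained without integrals.  Averages over
    a fine grid replace them, and analyticity enters only as a first-order
    Taylor bound with uniform constant ([unif_taylor]), which is stable under
    sums, products and composition and which suffices to move a grid average
    to another height in the strip ([contour_shift]).  The sum X is truncated
    to |m| <= M; it is then periodic up to an error that tends to 0 with 1/M.
    Convergence of the cosine series is replaced by Fejer means on the same
    grid, whose error is uniform in t and M because log X is 1-Lipschitz. *)

(** * The complex exponential *)

Section ComplexExponential.
Variable R : realType.
Implicit Types (x y : R) (z w d : R[i]).

Lemma sin_le_id x : 0 <= x -> sin x <= x.
Proof.
move=> x0; have [c _] : exists2 c, c \in `[0, x] & sin x - sin 0 = cos c * (x - 0).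
  apply: MVT_segment => //.
  by apply: continuous_subspaceT => y; exact: continuous_sin.
by rewrite sin0 !subr0 => ->; rewrite ler_piMl// cos_le1.
Qed.

Lemma cos_ge1Bsqr x : 1 - x ^+ 2 / 2 <= cos x.
Proof.
have H y : 0 <= y -> 1 - y ^+ 2 / 2 <= cos y.
  move=> y0; have -> : cos y = 1 - sin (y / 2) ^+ 2 *+ 2.
    by rewrite [in LHS](splitr y) -mulr2n cos_mulr2n sin2cos2; ring.
  have y2 : 0 <= y / 2 by rewrite divr_ge0.
  have h1 : sin (y / 2) <= y / 2 by exact: sin_le_id.
  have h2 : - (y / 2) <= sin (y / 2).
    have [yp|yp] := leP (y / 2) pi.
      by rewrite (@le_trans _ _ 0) ?oppr_le0// sin_ge0_pi// y2.
    rewrite (le_trans _ (sin_geN1 _))// lerN2 (le_trans _ (ltW yp))//.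
    by rewrite (le_trans _ (pi_ge2 R))// ler1n.
  have : sin (y / 2) ^+ 2 <= (y / 2) ^+ 2.
    by rewrite -[leLHS]real_normK ?num_real// lerXn2r ?nnegrE// ler_norml h1 h2.
  by move=> ?; lra.
by rewrite -cos_norm -[x ^+ 2]real_normK ?num_real// H.
Qed.

Lemma sin_ge_idBsqr x : 0 <= x <= 1 -> x - x ^+ 2 <= sin x.
Proof.
move=> /andP[x0 x1].
have [c] : exists2 c, c \in `[0, x] & sin x - sin 0 = cos c * (x - 0).
  apply: MVT_segment => //.
  by apply: continuous_subspaceT => y; exact: continuous_sin.
rewrite in_itv/= => /andP[c0 cx]; rewrite sin0 !subr0 => ->.
have := cos_ge1Bsqr c; have : c ^+ 2 <= x ^+ 2 by nra.
by move=> ? ?; nra.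
Qed.

Lemma expR_le_quad x : `|x| <= 1 / 2 -> expR x <= 1 + x + 2 * x ^+ 2.
Proof.
rewrite ler_norml => /andP[h1 h2].
have : (1 - x) * expR x <= 1.
  have := expR_ge1Dx (- x); rewrite expRN => h.
  have e0 := expR_gt0 x.
  by rewrite -ler_pdivlMr// div1r.
have e0 := expR_gt0 x.
nra.
Qed.

Lemma normc_ge0 z : 0 <= normc z.
Proof. by case: z => a b; rewrite sqrtr_ge0. Qed.

Lemma normcE2 z : normc z ^+ 2 = complex.Re z ^+ 2 + complex.Im z ^+ 2.
Proof. by case: z => a b /=; rewrite sqr_sqrtr// addr_ge0 ?sqr_ge0. Qed.

Lemma normc_le z (r : R) : 0 <= r -> normc z ^+ 2 <= r ^+ 2 -> normc z <= r.
Proof. by move=> r0; rewrite ler_pXn2r// nnegrE// normc_ge0. Qed.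

Lemma normc_Re z : `|complex.Re z| <= normc z.
Proof.
rewrite -(@ler_pXn2r _ 2)// ?nnegrE ?normc_ge0//.
by rewrite real_normK ?num_real// normcE2 lerDl sqr_ge0.
Qed.

Lemma normc_le_ReIm z : normc z <= `|complex.Re z| + `|complex.Im z|.
Proof.
apply: normc_le; first by rewrite addr_ge0.
rewrite normcE2 sqrrD !real_normK ?num_real//.
by rewrite addrAC lerDl mulrn_wge0// mulr_ge0.
Qed.

Lemma normc_real x : normc x%:C = `|x|.
Proof. by rewrite /= expr0n addr0 sqrtr_sqr. Qed.

Lemma normcB z w : normc (z - w) = normc (w - z).
Proof. by rewrite -opprB normcN. Qed.

Lemma le_normcB z w : normc (z - w) <= normc z + normc w.
Proof. by rewrite -(normcN w); exact: le_normcD. Qed.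

Lemma le_normc_sum (I : Type) (s : seq I) (P : pred I) (F : I -> R[i]) :
  normc (\sum_(i <- s | P i) F i) <= \sum_(i <- s | P i) normc (F i).
Proof.
elim/big_ind2 : _ => [|x1 x2 y1 y2 h1 h2|//]; first by rewrite normc0.
by apply: (le_trans (le_normcD _ _)); exact: lerD.
Qed.

Definition cexp z : R[i] :=
  (expR (complex.Re z))%:C * (cos (complex.Im z) +i* sin (complex.Im z)).

Lemma cexpD z w : cexp (z + w) = cexp z * cexp w.
Proof.
case: z w => [a b] [c d]; rewrite /cexp /= expRD cosD sinD; simpc.
by congr (_ +i* _); ring.
Qed.

Lemma cexp_real x : cexp x%:C = (expR x)%:C.
Proof. by rewrite /cexp /= cos0 sin0; simpc. Qed.

Lemma normc_cexp z : normc (cexp z) = expR (complex.Re z).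
Proof.
by rewrite /cexp normcM normc_real /= cos2Dsin2 sqrtr1 mulr1 ger0_norm// expR_ge0.

Qed.

(** For |d| > 1/2 the triangle inequality is enough; for |d| <= 1/2 the real and
    imaginary parts are estimated with the quadratic bounds on expR, cos and sin. *)
Lemma cexp_Taylor0 d : normc (cexp d - 1 - d) <=
  (6 + 4 * expR (complex.Re d)) * normc d ^+ 2.
Proof.
have d0 := normc_ge0 d; have e0 := expR_gt0 (complex.Re d).
have [dle|dgt] := leP (normc d) (1 / 2); last first.
  apply: (le_trans (le_normcB _ _)).
  have := le_normcB (cexp d) 1; rewrite normc_cexp normc1 => h.
  have h1 : 1 <= 4 * normc d ^+ 2 by nra.
  have h2 : normc d <= 2 * normc d ^+ 2 by nra.
  nra.
apply: (@le_trans _ _ (6 * normc d ^+ 2)); last first.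
  by rewrite ler_wpM2r ?sqr_ge0// lerDl mulr_ge0 ?ltW.
have hx := le_trans (normc_Re d) dle.
have hy : `|complex.Im d| <= 1 / 2.
  apply: le_trans dle; rewrite -(@ler_pXn2r _ 2)// ?nnegrE ?normc_ge0//.
  by rewrite real_normK ?num_real// normcE2 lerDr sqr_ge0.
apply: le_trans (normc_le_ReIm _) _; rewrite normcE2.
case: d {dle d0} e0 hx hy => x y /= e0 hx hy.
have q1 := expR_le_quad hx; have q2 := expR_ge1Dx x.
have c1 := cos_ge1Bsqr y; have c2 := cos_le1 y.
have s1 : `|sin y - y| <= y ^+ 2.
  have H (u : R) : 0 <= u -> u <= 1 / 2 -> `|sin u - u| <= u ^+ 2.
    move=> u0 u1; rewrite ler_norml; have := sin_le_id u0.
    have u2 : 0 <= u <= 1 by lra.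
    have := sin_ge_idBsqr u2; move=> ? ?; apply/andP; split; nra.
  have [y0|y0] := leP 0 y; first by rewrite H// (le_trans (ler_norm _)).
  have := H (- y); rewrite sinN sqrrN -opprD normrN; apply; first lra.
  by rewrite (le_trans (ler_norm _))// normrN.
move: hx hy s1; rewrite !ler_norml => /andP[x1 x2] /andP[y1 y2] /andP[s1 s2].
have e2 : expR x <= 2 by nra.
have a1 : `|expR x * cos y - 0 * sin y - 1 - x| <= 2 * x ^+ 2 + y ^+ 2.
  have p1 : 0 <= expR x * (1 - cos y) by rewrite mulr_ge0 ?(ltW e0)// subr_ge0.
  have p2 : expR x * (1 - cos y) <= 2 * (y ^+ 2 / 2).
    by apply: ler_pM => //; lra.
  have := sqr_ge0 x; have := sqr_ge0 y => ? ?.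
  have -> : expR x * cos y - 0 * sin y - 1 - x =
    (expR x - 1 - x) - expR x * (1 - cos y) by ring.
  by rewrite ler_norml; apply/andP; split; lra.
have a2 : `|expR x * sin y + 0 * cos y - 0 - y| <= 2 * y ^+ 2 + 2 * x ^+ 2 + 2 * y ^+ 2.
  have b1 : `|expR x * (sin y - y)| <= 2 * y ^+ 2.
    by rewrite normrM (ger0_norm (ltW e0)) ler_pM ?(ltW e0)// ler_norml s1 s2.
  have b2 : `|(expR x - 1) * y| <= 2 * x ^+ 2 + 2 * y ^+ 2.
    rewrite normrM.
    have [ne xe] : `|expR x - 1| <= 2 * `|x| /\ `|x| * `|x| = x ^+ 2.
      split; last by rewrite -expr2 real_normK ?num_real.
      by rewrite ler_norml; have [x0|x0] := leP 0 x;
        [rewrite ger0_norm//|rewrite ltr0_norm//]; apply/andP; split; nra.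
    have ye : `|y| * `|y| = y ^+ 2 by rewrite -expr2 real_normK ?num_real.
    have := normr_ge0 y; have := normr_ge0 x; have := sqr_ge0 (`|x| - `|y|).
    by move=> ? ? ?; nra.
  have -> : expR x * sin y + 0 * cos y - 0 - y =
    expR x * (sin y - y) + (expR x - 1) * y by ring.
  by apply: (le_trans (ler_normD _ _)); rewrite (le_trans (lerD b1 b2))//; lra.
have := sqr_ge0 x; have := sqr_ge0 y => ? ?.
by apply: (le_trans (lerD a1 a2)); lra.
Qed.
End ComplexExponential.

(** * Uniform first-order Taylor bounds *)

Section UniformTaylor.
Variable R : realType.
Implicit Types (z w : R[i]).

(** A quantitative substitute for analyticity: the inequality holds between any two
    points of D, and g' is the complex derivative of g in the interior of D. *)
Definition taylor_bound (C : R) (D : R[i] -> Prop) (g g' : R[i] -> R[i]) :=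
  forall z w, D z -> D w ->
    [/\ normc (g z) <= C, normc (g' z) <= C
      & normc (g w - g z - g' z * (w - z)) <= C * normc (w - z) ^+ 2].

(** The family is indexed because the constant must be shared by all its members:
    below, the index is the time t in e^{-tX}, or the pair of t and a frequency. *)
Definition unif_taylor (I : Type) (D : I -> R[i] -> Prop)
    (g : I -> R[i] -> R[i]) :=
  exists C, exists g', 0 <= C /\ forall i, taylor_bound C (D i) (g i) (g' i).

(** For nearby points this is the Taylor bound; for |w - z| > 1 it is the bound on
    the values. *)
Lemma taylor_lipschitz C D g g' z w : taylor_bound C D g g' -> D z -> D w ->
  normc (g w - g z) <= 2 * C * normc (w - z).
Proof.
move=> H Dz Dw; have [h1 h2 h3] := H z w Dz Dw; have [h4 _ _] := H w z Dw Dz.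
have d0 := normc_ge0 (w - z).
have C0 : 0 <= C by apply: le_trans h1; exact: normc_ge0.
have [d1|d1] := leP (normc (w - z)) 1.
  have -> : g w - g z = (g w - g z - g' z * (w - z)) + g' z * (w - z) by ring.
  apply: (le_trans (le_normcD _ _)); rewrite normcM.
  have : normc (g' z) * normc (w - z) <= C * normc (w - z) by rewrite ler_wpM2r.
  have : C * normc (w - z) ^+ 2 <= C * normc (w - z) by rewrite ler_wpM2l// expr2 ler_piMr.
  by move=> ? ?; lra.
apply: (le_trans (le_normcB _ _)).
have : 2 * C <= 2 * C * normc (w - z) by rewrite ler_peMr ?(ltW d1)// mulr_ge0.
by move=> ?; lra.
Qed.

Lemma unif_taylor_index (I J : Type) (D : I -> R[i] -> Prop)
    (E : J -> R[i] -> Prop) (f : J -> I) g :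
  (forall j z, E j z -> D (f j) z) ->
  unif_taylor D g -> unif_taylor E (fun j => g (f j)).
Proof.
move=> ED [C [g' [C0 H]]]; exists C, (fun j => g' (f j)); split=> // j z w Ez Ew.
by apply: H; exact: ED.
Qed.

Lemma unif_taylorD (I : Type) (D : I -> R[i] -> Prop) f g :
  unif_taylor D f -> unif_taylor D g ->
  unif_taylor D (fun i z => f i z + g i z).
Proof.
move=> [C [f' [C0 Hf]]] [C1 [g' [C10 Hg]]].
exists (C + C1), (fun i z => f' i z + g' i z); split; first exact: addr_ge0.
move=> i z w Dz Dw; have [h1 h2 h3] := Hf i z w Dz Dw.
have [k1 k2 k3] := Hg i z w Dz Dw; split.
- by apply: (le_trans (le_normcD _ _)); exact: lerD.
- by apply: (le_trans (le_normcD _ _)); exact: lerD.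
have -> : f i w + g i w - (f i z + g i z) - (f' i z + g' i z) * (w - z) =
  (f i w - f i z - f' i z * (w - z)) + (g i w - g i z - g' i z * (w - z)) by ring.
by apply: (le_trans (le_normcD _ _)); rewrite mulrDl; exact: lerD.
Qed.

Lemma unif_taylorM (I : Type) (D : I -> R[i] -> Prop) f g :
  unif_taylor D f -> unif_taylor D g ->
  unif_taylor D (fun i z => f i z * g i z).
Proof.
move=> [C [f' [C0 Hf]]] [C1 [g' [C10 Hg]]].
have CC : 0 <= C * C1 by exact: mulr_ge0.
exists (6 * (C * C1)), (fun i z => f' i z * g i z + f i z * g' i z).
split; first exact: mulr_ge0.
move=> i z w Dz Dw; have [h1 h2 h3] := Hf i z w Dz Dw.
have [k1 k2 k3] := Hg i z w Dz Dw.
have h4 := taylor_lipschitz (Hf i) Dz Dw.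
have k4 := taylor_lipschitz (Hg i) Dz Dw.
split.
- rewrite normcM; have := ler_pM (normc_ge0 _) (normc_ge0 _) h1 k1.
  by move=> ?; lra.
- apply: (le_trans (le_normcD _ _)); rewrite !normcM.
  have := ler_pM (normc_ge0 _) (normc_ge0 _) h2 k1.
  have := ler_pM (normc_ge0 _) (normc_ge0 _) h1 k2.
  by move=> ? ?; lra.
have -> : f i w * g i w - f i z * g i z -
  (f' i z * g i z + f i z * g' i z) * (w - z) =
  (f i w - f i z - f' i z * (w - z)) * g i z +
  f i z * (g i w - g i z - g' i z * (w - z)) +
  (f i w - f i z) * (g i w - g i z) by ring.
apply: (le_trans (le_normcD _ _)); rewrite normcM.
have A := le_normcD ((f i w - f i z - f' i z * (w - z)) * g i z)
  (f i z * (g i w - g i z - g' i z * (w - z))).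
rewrite !normcM in A.
have a1 := ler_pM (normc_ge0 _) (normc_ge0 _) h3 k1.
have a2 := ler_pM (normc_ge0 _) (normc_ge0 _) h1 k3.
have a3 := ler_pM (normc_ge0 _) (normc_ge0 _) h4 k4.
have -> : 6 * (C * C1) * normc (w - z) ^+ 2 = C * normc (w - z) ^+ 2 * C1 +
  C * (C1 * normc (w - z) ^+ 2) + 2 * C * normc (w - z) * (2 * C1 * normc (w - z)).
  by ring.
by apply: lerD a3; apply: (le_trans A); exact: lerD.
Qed.

Lemma unif_taylor_comp (I : Type) (D E : I -> R[i] -> Prop) g f :
  (forall i z, D i z -> E i (g i z)) ->
  unif_taylor D g -> unif_taylor E f ->
  unif_taylor D (fun i z => f i (g i z)).
Proof.
move=> DE [C [g' [C0 Hg]]] [C1 [f' [C10 Hf]]].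
have CC : 0 <= C * C1 by exact: mulr_ge0.
have C2C : 0 <= C1 * C ^+ 2 by rewrite mulr_ge0// sqr_ge0.
exists (C1 + C1 * C + 4 * (C1 * C ^+ 2)), (fun i z => f' i (g i z) * g' i z).
split; first by rewrite !addr_ge0 ?mulr_ge0 ?sqr_ge0.
move=> i z w Dz Dw; have [h1 h2 h3] := Hg i z w Dz Dw.
have [k1 k2 k3] := Hf i (g i z) (g i w) (DE _ _ Dz) (DE _ _ Dw).
have h4 := taylor_lipschitz (Hg i) Dz Dw.
split.
- by apply: (le_trans k1); rewrite -addrA lerDl addr_ge0// ?mulr_ge0 ?sqr_ge0.
- rewrite normcM; apply: (le_trans (ler_pM (normc_ge0 _) (normc_ge0 _) k2 h2)).
  by rewrite addrAC lerDr addr_ge0// ?mulr_ge0 ?sqr_ge0.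
have -> : f i (g i w) - f i (g i z) - f' i (g i z) * g' i z * (w - z) =
  (f i (g i w) - f i (g i z) - f' i (g i z) * (g i w - g i z)) +
  f' i (g i z) * (g i w - g i z - g' i z * (w - z)) by ring.
apply: (le_trans (le_normcD _ _)); rewrite normcM.
have a1 := ler_pM (normc_ge0 _) (normc_ge0 _) k2 h3.
have a2 : C1 * normc (g i w - g i z) ^+ 2 <= C1 * (2 * C * normc (w - z)) ^+ 2.
  by rewrite ler_wpM2l// lerXn2r ?nnegrE ?normc_ge0// !mulr_ge0// normc_ge0.
apply: (le_trans (lerD (le_trans k3 a2) a1)).
have -> : (C1 + C1 * C + 4 * (C1 * C ^+ 2)) * normc (w - z) ^+ 2 =
  C1 * (2 * C * normc (w - z)) ^+ 2 + C1 * (C * normc (w - z) ^+ 2) +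
  C1 * normc (w - z) ^+ 2 by ring.
by rewrite lerDl mulr_ge0// sqr_ge0.
Qed.

Lemma unif_taylor_cst (I : Type) (D : I -> R[i] -> Prop) (c : R[i]) :
  unif_taylor D (fun _ _ => c).
Proof.
exists (normc c), (fun _ _ => 0); split; first exact: normc_ge0.
move=> i z w _ _; split; rewrite ?normc0 ?normc_ge0//.
by rewrite subrr mul0r subr0 normc0 mulr_ge0 ?sqr_ge0 ?normc_ge0.
Qed.

Lemma unif_taylor_sum (I : Type) (D : I -> R[i] -> Prop) (n : nat)
    (g : nat -> I -> R[i] -> R[i]) :
  (forall k, unif_taylor D (g k)) ->
  unif_taylor D (fun i z => \sum_(k < n) g k i z).
Proof.
move=> H; elim: n => [|n IH].
  have [C [g' [C0 h]]] := unif_taylor_cst D 0.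
  exists C, g'; split=> // i z w Dz Dw; rewrite !big_ord0; exact: h.
have [C [g' [C0 h]]] := unif_taylorD IH (H n).
exists C, g'; split=> // i z w Dz Dw; rewrite !big_ord_recr/=; exact: h.
Qed.

Lemma unif_taylor_scale (I : Type) (D : I -> R[i] -> Prop) (c : I -> R[i])
    (B : R) : 0 <= B ->
  (forall i z, D i z -> normc z <= B) -> (forall i, normc (c i) <= B) ->
  unif_taylor D (fun i z => c i * z).
Proof.
move=> B0 DB cB; exists (B + B * B), (fun i _ => c i).
have BB : 0 <= B * B by exact: mulr_ge0.
split; first exact: addr_ge0.
move=> i z w Dz Dw; split.
- rewrite normcM (le_trans (ler_pM (normc_ge0 _) (normc_ge0 _) (cB i) (DB _ _ Dz)))//.
  by rewrite lerDr.
- by apply: (le_trans (cB i)); rewrite lerDl.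
have -> : c i * w - c i * z - c i * (w - z) = 0 by ring.
by rewrite normc0 mulr_ge0 ?sqr_ge0 ?addr_ge0.
Qed.

(** By cexp w = cexp z * cexp (w - z), the expansion at 0 suffices.  The
    constant depends on Re z and Re w only, so it is uniform on left half-planes. *)
Lemma cexp_remainder z w : normc (cexp w - cexp z - cexp z * (w - z)) <=
  (6 * expR (complex.Re z) + 4 * expR (complex.Re w)) * normc (w - z) ^+ 2.
Proof.
have -> : cexp w - cexp z - cexp z * (w - z) =
  cexp z * (cexp (w - z) - 1 - (w - z)).
  by rewrite [in LHS](_ : w = z + (w - z)) ?cexpD; [ring|rewrite addrC subrK].
rewrite normcM normc_cexp.
apply: (@le_trans _ _ (expR (complex.Re z) *
  ((6 + 4 * expR (complex.Re (w - z))) * normc (w - z) ^+ 2))).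
  by rewrite ler_wpM2l ?expR_ge0// cexp_Taylor0.
rewrite mulrA ler_wpM2r ?sqr_ge0//.
have <- : expR (complex.Re z) * expR (complex.Re (w - z)) = expR (complex.Re w).
  by rewrite -expRD; congr expR; case: z w => ? ? [? ?] /=; ring.
by rewrite le_eqVlt; apply/orP; left; apply/eqP; ring.
Qed.

Lemma unif_taylor_cexp (I : Type) (D : I -> R[i] -> Prop) (B : R) :
  (forall i z, D i z -> complex.Re z <= B) ->
  unif_taylor D (fun _ z => cexp z).
Proof.
move=> DB; have B0 := expR_gt0 B; exists (10 * expR B), (fun _ => @cexp R).
split; first by rewrite mulr_ge0// ltW.
have H i z : D i z -> expR (complex.Re z) <= expR B by move/DB; rewrite ler_expR.
move=> i z w Dz Dw; rewrite normc_cexp.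
have h1 := H _ _ Dz; have h2 := H _ _ Dw.
split; [lra|lra|apply: (le_trans (cexp_remainder _ _))].
by rewrite ler_wpM2r ?sqr_ge0//; lra.
Qed.

Lemma unif_taylor_inv (I : Type) (D : I -> R[i] -> Prop) (c : R) : 0 < c ->
  (forall i z, D i z -> c <= normc z) -> unif_taylor D (fun _ z => z^-1).
Proof.
move=> c0 DB; exists (c^-1 + c^-1 ^+ 2 + c^-1 ^+ 3), (fun _ z => - z^-1 ^+ 2).
have ci : 0 < c^-1 by rewrite invr_gt0.
have [c2 c3] : 0 < c^-1 ^+ 2 /\ 0 < c^-1 ^+ 3 by split; exact: exprn_gt0.
split; first lra.
have H i z : D i z -> normc z^-1 <= c^-1 /\ z != 0.
  move=> /DB h; split.
    by rewrite normcV lef_pV2// posrE// (lt_le_trans c0).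
  by apply/eqP => z0; rewrite z0 normc0 leNgt c0 in h.
move=> i z w Dz Dw; have [h1 z0] := H _ _ Dz; have [h2 w0] := H _ _ Dw.
have sq : normc z^-1 * normc z^-1 <= c^-1 ^+ 2 by rewrite expr2 ler_pM ?normc_ge0.
split; first lra.
  by rewrite normcN expr2 normcM; lra.
have -> : w^-1 - z^-1 - - z^-1 ^+ 2 * (w - z) = z^-1 * z^-1 * w^-1 * (w - z) * (w - z).
  by field; rewrite z0 w0.
rewrite !normcM -mulrA -expr2 ler_wpM2r ?sqr_ge0//.
apply: (@le_trans _ _ (c^-1 ^+ 2 * c^-1)); last by rewrite -exprSr; lra.
by rewrite ler_pM ?mulr_ge0 ?normc_ge0.
Qed.

(** The second-order constant is of order t^2 e^{-tp}, which is bounded in t since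
    e^{tp} >= (tp)^2/2.  This is where Re z >= p > 0 is needed. *)
Lemma unif_taylor_expt (p : R) : 0 < p ->
  unif_taylor (fun t z => 0 <= t /\ p <= complex.Re z)
    (fun t z => cexp (- t%:C * z)).
Proof.
move=> p0; exists (1 + p^-1 + 20 * p^-1 ^+ 2), (fun t z => - t%:C * cexp (- t%:C * z)).
have pi0 : 0 < p^-1 by rewrite invr_gt0.
have pi2 : 0 < p^-1 ^+ 2 by rewrite exprn_gt0.
split; first lra.
have ReE (t : R) z : complex.Re (- t%:C * z) = - (t * complex.Re z).
  by case: z => a b /=; ring.
move=> t z w [t0 pz] [_ pw]; rewrite [normc (_ * cexp _)]normcM !normc_cexp normcN normc_real ger0_norm//.
have E y : p <= y -> [/\ expR (- (t * y)) <= 1, t * expR (- (t * y)) <= p^-1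
    & t ^+ 2 * expR (- (t * y)) <= 2 * p^-1 ^+ 2].
  move=> py; have ty : t * p <= t * y by rewrite ler_wpM2l.
  have tp : 0 <= t * p by rewrite mulr_ge0// ltW.
  have e : expR (- (t * y)) <= (expR (t * p))^-1 by rewrite -expRN ler_expR lerN2.
  have e1 := expR_ge1Dxn 0 tp; have e2 := expR_ge1Dxn 1 tp.
  have e0 := expR_gt0 (t * p); have e3 := expR_ge0 (- (t * y)).
  rewrite divr1 expr1 in e1; rewrite (_ : (2`!)%:R = 2) // in e2.
  split.
  - by rewrite expR_le1 oppr_le0 (le_trans tp).
  - apply: (le_trans (ler_wpM2l t0 e)); rewrite ler_pdivrMr//.
    by rewrite mulrC ler_pdivlMr//; lra.
  apply: (le_trans (ler_wpM2l (sqr_ge0 t) e)); rewrite ler_pdivrMr// mulrAC exprVn.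
  by rewrite ler_pdivlMr ?exprn_gt0// -exprMn; lra.
rewrite ReE; have [a1 a2 a3] := E _ pz; have [b1 b2 b3] := E _ pw.
split; [lra|lra|].
have -> : cexp (- t%:C * w) - cexp (- t%:C * z) - - t%:C * cexp (- t%:C * z) * (w - z) =
  cexp (- t%:C * w) - cexp (- t%:C * z) - cexp (- t%:C * z) * (- t%:C * w - - t%:C * z).
  by ring.
apply: (le_trans (cexp_remainder _ _)).
rewrite -mulrBr normcM normcN normc_real ger0_norm// exprMn mulrA.
rewrite ler_wpM2r ?sqr_ge0// !ReE mulrDl.
by move: (t ^+ 2) (expR (- (t * complex.Re z))) (expR (- (t * complex.Re w))) a3 b3 => *; lra.
Qed.

End UniformTaylor.

(** * Moving a grid average in the complex plane *)

Section ContourShift.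
Variable R : realType.

(** A discrete form of Cauchy's theorem on the parallelogram with corner o and
    sides p and v.  On each row the sum of g' times the horizontal step
    telescopes, up to second-order errors, to the difference mu between the two
    ends; hence the sum of g' times the vertical step, which is the change of the
    row sum from one row to the next, is small as well.  For g of period p one may
    take mu = 0. *)
Lemma contour_shift (C mu : R) (D : R[i] -> Prop) (g g' : R[i] -> R[i])
    (N : nat) (o p v : R[i]) (pt := fun j k : nat =>
      o + (j%:R / N%:R) * p + (k%:R / N%:R) * v) :
  (0 < N)%N -> p != 0 -> 0 <= C -> taylor_bound C D g g' ->
  (forall j k, (j <= N)%N -> (k <= N)%N -> D (pt j k)) ->
  (forall k, (k < N)%N -> normc (g (pt N k) - g (pt 0%N k)) <= mu) ->
  normc (\sum_(j < N) g (pt j N) - \sum_(j < N) g (pt j 0%N)) <=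
    N%:R * (normc v / normc p * mu) + C * normc v * (normc p + normc v).
Proof.
move=> N0 p0 C0 H Dpt Hmu.
have NC0 : (N%:R : R[i]) != 0 by rewrite pnatr_eq0 -lt0n.
have NR0 : 0 < (N%:R : R) by rewrite ltr0n.
have np0 : 0 < normc p.
  by rewrite lt_neqAle normc_ge0 andbT eq_sym; apply: contra p0 => /eqP/eq0_normc ->.
have normcNV (u : R[i]) : normc (u / N%:R) = normc u / N%:R.
  by rewrite normcM normcV -(rmorph_nat (real_complex R)) normc_real ger0_norm// ltW.
pose A k := \sum_(j < N) g' (pt j k).
(* Each row: the telescoping sum bounds the sum of g' over the row. *)
have rowp k : (k < N)%N -> normc (A k) * normc p <= N%:R * mu + C * normc p ^+ 2.
  move=> kN; have e : \sum_(j < N) (g (pt j.+1 k) - g (pt j k) - g' (pt j k) * (p / N%:R))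
      = g (pt N k) - g (pt 0%N k) - A k * (p / N%:R).
    rewrite sumrB -mulr_suml; congr (_ - _).
    by rewrite -(big_mkord xpredT (fun j => g (pt j.+1 k) - g (pt j k))) telescope_sumr.
  have : normc (g (pt N k) - g (pt 0%N k) - A k * (p / N%:R)) <=
      \sum_(j < N) C * normc (p / N%:R) ^+ 2.
    rewrite -e; apply: (le_trans (le_normc_sum _ _ _)); apply: ler_sum => j _.
    have [_ _] := H (pt j k) (pt j.+1 k) (Dpt _ _ (ltnW (ltn_ord j)) (ltnW kN))
      (Dpt _ _ (ltn_ord j) (ltnW kN)).
    have -> // : pt j.+1 k - pt j k = p / N%:R.
    by rewrite /pt -addn1 natrD; field.
  rewrite sumr_const card_ord -[X in _ <= X -> _]mulr_natl normcNV.
  have := Hmu k kN; have := le_normcB (g (pt N k) - g (pt 0%N k))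
    (g (pt N k) - g (pt 0%N k) - A k * (p / N%:R)).
  rewrite subKr normcM normcNV => h1 h2 h3.
  have h : normc (A k) * (normc p / N%:R) <= mu + N%:R * (C * (normc p / N%:R) ^+ 2).
    by apply: (le_trans h1); exact: lerD.
  have := ler_wpM2l (ltW NR0) h.
  have -> : N%:R * (normc (A k) * (normc p / N%:R)) = normc (A k) * normc p.
    by field; rewrite gt_eqF.
  have -> // : N%:R * (mu + N%:R * (C * (normc p / N%:R) ^+ 2)) =
    N%:R * mu + C * normc p ^+ 2 by field; rewrite gt_eqF.
(* From one row to the next the same sum of g' is multiplied by v / N. *)
have rowv k : (k < N)%N ->
  normc (\sum_(j < N) g (pt j k.+1) - \sum_(j < N) g (pt j k)) <=
  normc v / normc p * mu + C * normc v * (normc p + normc v) / N%:R.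
  move=> kN; have e : \sum_(j < N) (g (pt j k.+1) - g (pt j k) - g' (pt j k) * (v / N%:R))
      = \sum_(j < N) g (pt j k.+1) - \sum_(j < N) g (pt j k) - A k * (v / N%:R).
    by rewrite !sumrB -mulr_suml.
  have : normc (\sum_(j < N) g (pt j k.+1) - \sum_(j < N) g (pt j k) - A k * (v / N%:R))
      <= \sum_(j < N) C * normc (v / N%:R) ^+ 2.
    rewrite -e; apply: (le_trans (le_normc_sum _ _ _)); apply: ler_sum => j _.
    have [_ _] := H (pt j k) (pt j k.+1) (Dpt _ _ (ltnW (ltn_ord j)) (ltnW kN))
      (Dpt _ _ (ltnW (ltn_ord j)) kN).
    have -> // : pt j k.+1 - pt j k = v / N%:R.
    by rewrite /pt -addn1 natrD; field.
  rewrite sumr_const card_ord -[X in _ <= X -> _]mulr_natl normcNV => h1.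
  set S := \sum_(j < N) g (pt j k.+1) - _.
  have := le_normcD (S - A k * (v / N%:R)) (A k * (v / N%:R)).
  rewrite subrK normcM normcNV => h2; apply: (le_trans h2).
  apply: (le_trans (lerD h1 (lexx _))).
  have h3 : normc (A k) * (normc v / N%:R) <=
      normc v / normc p / N%:R * (N%:R * mu + C * normc p ^+ 2).
    have -> : normc (A k) * (normc v / N%:R) =
        normc v / normc p / N%:R * (normc (A k) * normc p).
      by field; rewrite !gt_eqF.
    by rewrite ler_wpM2l ?rowp// !mulr_ge0 ?invr_ge0 ?normc_ge0// ltW.
  apply: (le_trans (lerD (lexx _) h3)); rewrite le_eqVlt; apply/orP; left; apply/eqP.
  by field; rewrite !gt_eqF.
have -> : \sum_(j < N) g (pt j N) - \sum_(j < N) g (pt j 0%N) =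
  \sum_(k < N) (\sum_(j < N) g (pt j k.+1) - \sum_(j < N) g (pt j k)).
  rewrite -(big_mkord xpredT (fun k => \sum_(j < N) g (pt j k.+1) - \sum_(j < N) g (pt j k))).
  by rewrite telescope_sumr.
apply: (le_trans (le_normc_sum _ _ _)).
apply: (@le_trans _ _ (\sum_(k < N) (normc v / normc p * mu +
   C * normc v * (normc p + normc v) / N%:R))).
  by apply: ler_sum => k _; exact: rowv.
rewrite sumr_const card_ord -[leLHS]mulr_natl mulrDr lerD2l.
by rewrite mulrC divfK// gt_eqF.
Qed.

End ContourShift.

(** * Periodized hyperbolic secants *)

Section SechSum.
Variable R : realType.
Implicit Types (x y L : R) (z w : R[i]) (M : nat).

Definition coshr x : R := (expR x + expR (- x)) / 2.
Definition sinhr x : R := (expR x - expR (- x)) / 2.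
Definition cosh z : R[i] := (cexp z + cexp (- z)) / 2.

Lemma coshrN x : coshr (- x) = coshr x.
Proof. by rewrite /coshr opprK addrC. Qed.

Lemma coshr_gt0 x : 0 < coshr x.
Proof. by rewrite divr_gt0// addr_gt0// expR_gt0. Qed.

Lemma coshr_sqr x : coshr x ^+ 2 = 1 + sinhr x ^+ 2.
Proof.
have := expRxMexpNx_1 x; rewrite /coshr /sinhr => h.
have -> : ((expR x + expR (- x)) / 2) ^+ 2 =
  expR x * expR (- x) + ((expR x - expR (- x)) / 2) ^+ 2 by field.
by rewrite h.
Qed.


Lemma coshr_le_expR x y : coshr x <= expR `|x - y| * coshr y.
Proof.
rewrite /coshr mulrA ler_pM2r// mulrDr -!expRD lerD// ler_expR.
  by rewrite -lerBlDr ler_norm.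
by rewrite -lerBlDr -opprD -normrN ler_norm.
Qed.

Lemma coshr_ge_half x : expR `|x| / 2 <= coshr x.
Proof.
rewrite /coshr ler_pM2r//.
have [x0|x0] := leP 0 x; first by rewrite ger0_norm// lerDl expR_ge0.
by rewrite ltr0_norm// lerDr expR_ge0.
Qed.

Lemma cosh_real x : cosh x%:C = (coshr x)%:C.
Proof.
by rewrite /cosh -rmorphN !cexp_real -rmorphD -(rmorph_nat (real_complex R)) -fmorph_div.
Qed.

Lemma coshE z : cosh z = (coshr (complex.Re z) * cos (complex.Im z)) +i*
  (sinhr (complex.Re z) * sin (complex.Im z)).
Proof.
case: z => x y; rewrite /cosh /cexp /coshr /sinhr /= cosN sinN.
rewrite -(rmorph_nat (real_complex R)) -fmorphV; simpc.
by congr (_ +i* _); ring.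
Qed.

Lemma normc_cosh z : normc (cosh z) ^+ 2 =
  sinhr (complex.Re z) ^+ 2 + cos (complex.Im z) ^+ 2.
Proof.
rewrite normcE2 coshE /= (exprMn _ (coshr _)) (exprMn _ (sinhr _)).
by rewrite coshr_sqr sin2cos2; ring.
Qed.

Lemma normc_cosh_le z : normc (cosh z) <= coshr (complex.Re z).
Proof.
apply: normc_le; first exact/ltW/coshr_gt0.
by rewrite normc_cosh coshr_sqr addrC lerD2r -[leRHS](cos2Dsin2 (complex.Im z)) lerDl sqr_ge0.
Qed.

Lemma normc_cosh_ge_cos z : 0 <= cos (complex.Im z) ->
  cos (complex.Im z) <= normc (cosh z).
Proof.
move=> c0; rewrite -(@ler_pXn2r _ 2)// ?nnegrE ?normc_ge0//.
by rewrite normc_cosh lerDr sqr_ge0.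
Qed.

Lemma normc_cosh_ge_sinh z : sinhr (complex.Re z) <= normc (cosh z).
Proof.
apply: (le_trans (ler_norm _)); rewrite -(@ler_pXn2r _ 2)// ?nnegrE ?normc_ge0//.
by rewrite real_normK ?num_real// normc_cosh lerDl sqr_ge0.
Qed.

Lemma coshN z : cosh (- z) = cosh z.
Proof. by rewrite /cosh opprK addrC. Qed.

Definition sech z := (cosh z)^-1.

(** The sign of Re (sech z) is that of cos (Im z): this is the positivity on the
    strip |Im z| < pi/2 on which everything rests. *)
Lemma Re_sech z : complex.Re (sech z) =
  coshr (complex.Re z) * cos (complex.Im z) / normc (cosh z) ^+ 2.
Proof. by rewrite normcE2 /sech coshE. Qed.

Lemma Re_sech_ge z : 0 <= cos (complex.Im z) ->
  cos (complex.Im z) / coshr (complex.Re z) <= complex.Re (sech z).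
Proof.
rewrite le_eqVlt => /orP[/eqP c0|c0].
  by rewrite Re_sech -c0 mulr0 !mul0r.
have k0 := coshr_gt0 (complex.Re z).
have n0 : 0 < normc (cosh z) by apply: lt_le_trans (normc_cosh_ge_cos (ltW c0)).
rewrite Re_sech ler_pdivlMr ?exprn_gt0// mulrAC ler_pdivrMr//.
rewrite [leRHS]mulrAC [leRHS]mulrC ler_pM2l// -expr2.
by rewrite lerXn2r ?nnegrE ?(ltW n0) ?(ltW k0)// normc_cosh_le.
Qed.

Lemma Re_sech_ge0 z : 0 <= cos (complex.Im z) -> 0 <= complex.Re (sech z).
Proof.
move=> c0; apply: le_trans (Re_sech_ge c0).
by rewrite divr_ge0// ltW// coshr_gt0.
Qed.

(** The terms with indices m and -m are added together, so that the truncated sum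
    stays even. *)
Definition sech_sum L M z : R[i] := sech z +
  \sum_(i < M) (sech (z + (2 * L * i.+1%:R)%:C) + sech (z - (2 * L * i.+1%:R)%:C)).

Definition sechr_sum L M x : R := (coshr x)^-1 +
  \sum_(i < M) ((coshr (x + 2 * L * i.+1%:R))^-1 + (coshr (x - 2 * L * i.+1%:R))^-1).

Lemma sech_sum_real L M x : sech_sum L M x%:C = (sechr_sum L M x)%:C.
Proof.
have H y : sech y%:C = ((coshr y)^-1)%:C by rewrite /sech cosh_real fmorphV.
rewrite /sech_sum /sechr_sum H rmorphD rmorph_sum; congr (_ + _).
by apply: eq_bigr => i _; rewrite -[x%:C + _]rmorphD -[x%:C - _]rmorphB !H -rmorphD.
Qed.

Lemma sechr_sumN L M x : sechr_sum L M (- x) = sechr_sum L M x.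
Proof.
rewrite /sechr_sum coshrN; congr (_ + _); apply: eq_bigr => i _.
rewrite addrC; congr (_^-1 + _^-1); rewrite -coshrN; congr coshr; ring.
Qed.

Lemma sechr_sum_norm L M x : sechr_sum L M `|x| = sechr_sum L M x.
Proof. by have [x0|x0] := leP 0 x; rewrite ?(ger0_norm x0)// (ltr0_norm x0) sechr_sumN. Qed.

Lemma sechr_sum_gt0 L M x : 0 < sechr_sum L M x.
Proof.
rewrite ltr_pwDl ?invr_gt0 ?coshr_gt0// sumr_ge0// => i _.
by rewrite addr_ge0// invr_ge0 ltW// coshr_gt0.
Qed.

(** The logarithm of sech is 1-Lipschitz, and a sum of positive functions with
    this property has it too.  The bound does not depend on the number of terms. *)
Lemma sechr_sum_log L M x y :
  sechr_sum L M x <= expR `|x - y| * sechr_sum L M y.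
Proof.
have H u v : `|u - v| = `|x - y| ->
    (coshr u)^-1 <= expR `|x - y| * (coshr v)^-1.
  move=> e; rewrite ler_pdivlMr ?coshr_gt0// ler_pdivrMl ?coshr_gt0//.
  by rewrite mulrC -e distrC coshr_le_expR.
rewrite /sechr_sum mulrDr; apply: lerD; first exact: H.
rewrite mulr_sumr; apply: ler_sum => i _; rewrite mulrDr; apply: lerD; apply: H; congr `|_|; ring.
Qed.

(** Translation by one period shifts the summation index by one, so only the two
    extreme terms differ. *)
Lemma sech_sum_shift L M z : sech_sum L M (z + (2 * L)%:C) - sech_sum L M z =
  sech (z + (2 * L * M.+1%:R)%:C) - sech (z - (2 * L * M%:R)%:C).
Proof.
elim: M => [|M IH]; first by rewrite /sech_sum !big_ord0 !addr0 mulr0 mulr1 subr0.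
have E w : sech_sum L M.+1 w = sech_sum L M w +
   (sech (w + (2 * L * M.+1%:R)%:C) + sech (w - (2 * L * M.+1%:R)%:C)).
  by rewrite /sech_sum big_ord_recr/= addrA.
have -> : sech_sum L M.+1 (z + (2 * L)%:C) = sech_sum L M z +
    sech (z + (2 * L * M.+1%:R)%:C) - sech (z - (2 * L * M%:R)%:C) +
    (sech (z + (2 * L * M.+2%:R)%:C) + sech (z - (2 * L * M%:R)%:C)).
  rewrite E; congr (_ + (sech _ + sech _)).
  - by rewrite -addrA -IH addrC subrK.
  - by rewrite -addrA -rmorphD; congr (_ + _%:C); rewrite -[M.+2]addn1 natrD; ring.
  - rewrite -addrA -rmorphB -rmorphN; congr (_ + _%:C).
    by rewrite -[M.+1]addn1 natrD; ring.
rewrite E; ring.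
Qed.

End SechSum.

Section SechSumBounds.
Variable R : realType.
Implicit Types (x y L : R) (z w : R[i]) (M : nat).

Lemma unif_taylor_sech (I : Type) (D : I -> R[i] -> Prop) (B c a : R) : 0 < c ->
  (forall i z, D i z -> normc z <= B /\ c <= cos (complex.Im z)) ->
  unif_taylor D (fun _ z => sech (z + a%:C)).
Proof.
move=> c0 DB.
pose B1 := `|B| + 1.
have B1n i z : D i z -> normc z <= B1.
  by move=> /DB[zB _]; rewrite (le_trans zB)// (le_trans (ler_norm _))// lerDl.
have Re_le i z : D i z -> `|complex.Re z| <= B1.
  by move=> /B1n zB; rewrite (le_trans (normc_Re z)).
have B10 : 0 <= B1 by rewrite addr_ge0.
have lin (s : R) : `|s| <= 1 ->
    unif_taylor D (fun _ z => s%:C * z + (s * a)%:C).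
  move=> s1; apply: unif_taylorD; last exact: unif_taylor_cst.
  apply: (@unif_taylor_scale _ _ D (fun _ => s%:C) B1) => //.
  by move=> _; rewrite normc_real (le_trans s1)// lerDr.
have lin_exp (s : R) : `|s| <= 1 ->
    unif_taylor D (fun _ z => cexp (s%:C * z + (s * a)%:C)).
  move=> s1; apply: (@unif_taylor_comp _ _ D
    (fun _ z => complex.Re z <= B1 + `|a|) _ (fun _ => @cexp R)) (lin s s1) _.
    move=> i z /Re_le; case: z => u v /= hu.
    rewrite mul0r subr0 -mulrDr (le_trans (ler_norm _))// normrM.
    rewrite -[leRHS]mul1r ler_pM// (le_trans (ler_normD _ _))// lerD2r.
    exact: hu.
  exact: (@unif_taylor_cexp _ _ _ (B1 + `|a|)).
have cosh_taylor : unif_taylor D (fun _ z => cosh (z + a%:C)).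
  have h1 : `|1 : R| <= 1 by rewrite normr1.
  have h2 : `|-1 : R| <= 1 by rewrite normrN1.
  have -> : (fun (_ : I) z => cosh (z + a%:C)) = (fun _ z =>
      (cexp (1%:C * z + (1 * a)%:C) + cexp ((-1)%:C * z + (-1 * a)%:C)) * 2^-1).
    apply/funext => _; apply/funext => z; rewrite /cosh.
    by rewrite ?(mul1r, mulN1r, rmorphN, rmorph1, opprD).
  by apply: unif_taylorM; [apply: unif_taylorD; exact: lin_exp|exact: unif_taylor_cst].
apply: (@unif_taylor_comp _ _ D (fun _ z => c <= normc z) _ (fun _ z => z^-1) _ cosh_taylor).
  move=> i z /DB[_ cz]; have e : complex.Im (z + a%:C) = complex.Im z.
    by case: z {cz} => u v /=; rewrite addr0.
  rewrite -e in cz; apply: (le_trans cz).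
  by apply: normc_cosh_ge_cos; rewrite (le_trans (ltW c0)).
exact: (unif_taylor_inv c0).
Qed.

Lemma unif_taylor_sech_sum (I : Type) (D : I -> R[i] -> Prop) (B c L : R) M : 0 < c ->
  (forall i z, D i z -> normc z <= B /\ c <= cos (complex.Im z)) ->
  unif_taylor D (fun _ z => sech_sum L M z).
Proof.
move=> c0 DB; apply: unif_taylorD.
  have [C [g' [C0 H]]] := unif_taylor_sech 0 c0 DB.
  exists C, g'; split=> // i z w Dz Dw; have := H i z w Dz Dw.
  by rewrite !addr0.
apply: (@unif_taylor_sum _ _ _ M (fun k _ z => sech (z + (2 * L * k.+1%:R)%:C) +
  sech (z - (2 * L * k.+1%:R)%:C))) => k.
apply: unif_taylorD; first exact: (unif_taylor_sech _ c0 DB).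
have := unif_taylor_sech (- (2 * L * k.+1%:R)) c0 DB.
by rewrite rmorphN.
Qed.

(** All terms have nonnegative real part; the central one gives the lower bound,
    independent of L and M. *)
Lemma Re_sech_sum_ge L M z : 0 <= cos (complex.Im z) ->
  cos (complex.Im z) / coshr (complex.Re z) <= complex.Re (sech_sum L M z).
Proof.
move=> c0; have ReD (u v : R[i]) : complex.Re (u + v) = complex.Re u + complex.Re v.
  by case: u v => ? ? [? ?].
rewrite /sech_sum ReD -[leLHS]addr0 lerD ?Re_sech_ge//.
elim/big_ind : _ => // [u v u0 v0|i _]; first by rewrite ReD addr_ge0.
by rewrite ReD addr_ge0// Re_sech_ge0//; case: z c0 => u v /=; rewrite ?subr0 ?addr0.
Qed.

Lemma sinhr_ge x : 0 <= x -> x / 2 <= sinhr x.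
Proof.
move=> x0; rewrite /sinhr ler_pM2r//; have := expR_ge1Dx x.
have : expR (- x) <= 1 by rewrite expR_le1 oppr_le0.
by move=> ? ?; lra.
Qed.

Lemma normc_sech_le z : complex.Re z != 0 -> normc (sech z) <= 2 / `|complex.Re z|.
Proof.
move=> z0; have H w : 0 < complex.Re w -> normc (sech w) <= 2 / complex.Re w.
  move=> w0; rewrite /sech normcV -[leRHS]invf_div lef_pV2 ?posrE//.
  - by apply: le_trans (normc_cosh_ge_sinh w); apply: sinhr_ge; exact: ltW.
  - apply: lt_le_trans (normc_cosh_ge_sinh w).
    by apply: lt_le_trans (sinhr_ge (ltW w0)); rewrite divr_gt0.
  - by rewrite divr_gt0.
have [zp|zn|zz] := ltgtP (complex.Re z) 0.
- rewrite ltr0_norm// /sech -coshN -/(sech (- z)).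
  have -> : - complex.Re z = complex.Re (- z) by case: z {z0 zp}.
  by apply: H; case: z zp {z0} => /= ? ?; rewrite oppr_gt0.
- by rewrite gtr0_norm// H.
- by rewrite zz eqxx in z0.
Qed.

(** The two terms left over by the translation sit at distance (2 M + 1) L from
    the imaginary axis. *)
Lemma sech_sum_mismatch L M z : 0 < L -> complex.Re z = - L ->
  normc (sech_sum L M (z + (2 * L)%:C) - sech_sum L M z) <= 4 / ((2 * M%:R + 1) * L).
Proof.
move=> L0 zL; rewrite sech_sum_shift; set d := (2 * M%:R + 1) * L.
have d0 : 0 < d by rewrite mulr_gt0// ltr_wpDl// mulr_ge0.
have e1 : complex.Re (z + (2 * L * M.+1%:R)%:C) = d.
  by case: z zL => u v /= ->; rewrite /d -addn1 natrD; ring.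
have e2 : complex.Re (z - (2 * L * M%:R)%:C) = - d.
  by case: z zL {e1} => u v /= ->; rewrite /d; ring.
apply: (le_trans (le_normcB _ _)).
have h1 := @normc_sech_le (z + (2 * L * M.+1%:R)%:C).
have h2 := @normc_sech_le (z - (2 * L * M%:R)%:C).
rewrite e1 gt_eqF// gtr0_norm// in h1; rewrite e2 oppr_eq0 gt_eqF// normrN gtr0_norm// in h2.
apply: (le_trans (lerD (h1 isT) (h2 isT))).
by rewrite -mulrDl -natrD.
Qed.

(** With q = e^{-L} = 1/(4 k), sech x <= 2 e^{-|x|} gives the geometric bound
    4 q / (1 - q^2) at L, that is k^{-1} / (1 - q^2), while the first neighbours of
    the central term give at least 1 + 2 q^2 at 0.  The constant 4 in L = log (4 k)
    is what makes the factor 4 q k equal to 1. *)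
Lemma sechr_sum_ratio (k : R) M : 1 <= k -> (0 < M)%N ->
  k * sechr_sum (ln (4 * k)) M (ln (4 * k)) <= sechr_sum (ln (4 * k)) M 0.
Proof.
move=> k1; set L := ln (4 * k) => M0.
have k4 : 0 < 4 * k by lra.
pose q := expR (- L).
have qE : q = (4 * k)^-1 by rewrite /q expRN lnK// posrE.
have L0 : 0 < L by rewrite ln_gt0//; lra.
have q0 : 0 < q by rewrite expR_gt0.
have q4 : q <= 1 / 4 by rewrite qE div1r lef_pV2// ?posrE//; lra.
have qk : 4 * k * q = 1 by rewrite qE mulfV// gt_eqF.
have qn n : expR (- (n%:R * L)) = q ^+ n by rewrite -mulrN expRM_natl.
have inv_coshr x : (coshr x)^-1 <= 2 * expR (- `|x|).
  rewrite -[leRHS]invrK lef_pV2 ?posrE ?coshr_gt0 ?invr_gt0 ?mulr_gt0 ?expR_gt0//.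
  by rewrite invfM expRN invrK mulrC coshr_ge_half.
have up : sechr_sum L M L <= 4 * q / (1 - q ^+ 2).
  have t n : \sum_(i < n) q ^+ (2 * i + 1) = (q - q ^+ (2 * n + 1)) / (1 - q ^+ 2).
    apply: (canRL (mulfK _)); first by rewrite gt_eqF//; nra.
    elim: n => [|n IH]; first by rewrite big_ord0 mul0r muln0 expr1 subrr.
    rewrite big_ord_recr/= mulrDl IH !mulnS !exprD; ring.
  apply: (@le_trans _ _ (2 * q + 2 * (1 + q ^+ 2) * \sum_(i < M) q ^+ (2 * i + 1))).
    apply: lerD; first by have := inv_coshr L; rewrite (gtr0_norm L0).
    rewrite mulr_sumr; apply: ler_sum => i _.
    have a1 : `|L + 2 * L * i.+1%:R| = (2 * i + 3)%:R * L.
      rewrite ger0_norm; last by rewrite addr_ge0 ?mulr_ge0 ?ltW.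
      by rewrite natrD natrM -[i.+1]addn1 natrD; ring.
    have a2 : `|L - 2 * L * i.+1%:R| = (2 * i + 1)%:R * L.
      rewrite distrC ger0_norm; last first.
        have := mulr_ge0 (ltW L0) (ler0n R i); rewrite -natr1 => ?.
        by rewrite subr_ge0; lra.
      by rewrite natrD natrM -[i.+1]addn1 natrD; ring.
    have := inv_coshr (L + 2 * L * i.+1%:R).
    have := inv_coshr (L - 2 * L * i.+1%:R).
    rewrite a1 a2 !qn => h1 h2; apply: (le_trans (lerD h2 h1)).
    rewrite le_eqVlt; apply/orP; left; apply/eqP.
    by rewrite !exprD; ring.
  rewrite t.
  have -> : 4 * q / (1 - q ^+ 2) = 2 * q + 2 * (1 + q ^+ 2) * (q / (1 - q ^+ 2)).
    by field; rewrite gt_eqF//; nra.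
  rewrite lerD2l ler_wpM2l//; first by rewrite mulr_ge0// addr_ge0// sqr_ge0.
  rewrite ler_wpM2r//; first by rewrite invr_ge0; nra.
  by rewrite gerBl exprn_ge0// ltW.
have low : 1 + 2 * q ^+ 2 <= sechr_sum L M 0.
  case: M M0 {up} => // M _; rewrite /sechr_sum.
  apply: lerD; first by rewrite /coshr oppr0 expR0 -(natrD _ 1 1) mulfV ?invr1.
  rewrite big_ord_recl/= -[leLHS]addr0; apply: lerD; last first.
    by apply: sumr_ge0 => i _; rewrite addr_ge0// invr_ge0 ltW// coshr_gt0.
  rewrite add0r sub0r coshrN mulr1.
  have h : q ^+ 2 <= (coshr (2 * L))^-1.
    rewrite -[leLHS]invrK lef_pV2 ?posrE ?coshr_gt0 ?invr_gt0 ?exprn_gt0//.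
    have L2 : 0 <= 2 * L by rewrite mulr_ge0// ltW.
    have : expR (- (2 * L)) <= expR (2 * L) by rewrite ler_expR ge0_cp.
    by rewrite -qn -expRN opprK /coshr => ?; rewrite ler_pdivrMr//; lra.
  by lra.
apply: le_trans low; apply: (@le_trans _ _ (k * (4 * q / (1 - q ^+ 2)))).
  by rewrite ler_wpM2l//; lra.
have -> : k * (4 * q / (1 - q ^+ 2)) = (4 * k * q) / (1 - q ^+ 2) by ring.
have qq : q ^+ 2 <= 1 / 4 by nra.
have := sqr_ge0 q; rewrite qk; move: (q ^+ 2) qq => t t1 t0.
by rewrite ler_pdivrMr; nra.
Qed.

Lemma continuous_sechr_sum L M : continuous (sechr_sum L M).
Proof.
have cosh_cont (a : R) : continuous (fun x : R => (coshr (x + a))^-1).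
  move=> x; apply: (@cvgV _ _ _ _ (fun x => coshr (x + a)) _).
    by rewrite gt_eqF// coshr_gt0.
  have ea : ((y + a)%R @[y --> x] --> (x + a)%R)%classic by apply: cvgD; [exact: cvg_id|exact: cvg_cst].
  apply: cvgM; last exact: cvg_cst.
  apply: cvgD; first by apply: (cvg_comp _ _ ea); exact: continuous_expR.
  by apply: (cvg_comp _ _ (cvgN ea)); exact: continuous_expR.
rewrite /sechr_sum => x; apply: cvgD.
  by have := cosh_cont 0 x; under eq_fun do rewrite addr0.
elim: M => [|M IH].
  under eq_fun do rewrite big_ord0; rewrite big_ord0; exact: cvg_cst.
under eq_fun do rewrite big_ord_recr; rewrite big_ord_recr /=.
by apply: cvgD => //; apply: cvgD; exact: cosh_cont.
Qed.

Lemma sechr_sum_onto L M (v : R) : 0 <= L ->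
  sechr_sum L M L <= v <= sechr_sum L M 0 ->
  exists2 s, 0 <= s <= L & sechr_sum L M s = v.
Proof.
move=> L0 /andP[v1 v2].
have [||s] := @IVT R (sechr_sum L M) 0 L v L0.
- by apply: continuous_subspaceT => x; exact: continuous_sechr_sum.
- by rewrite ge_min v1 orbT le_max v2.
- by rewrite in_itv/=; exists s.
Qed.

End SechSumBounds.

(** * Fejer means on a grid *)

Section Fejer.
Variable R : realType.
Implicit Types (x u a th : R) (n N K : nat).

(** This is the squared modulus of the geometric sum of e^{i(a + ju)} multiplied by
    e^{iu} - 1, written in real terms. *)
Lemma cos_sin_sum_sqr a u N :
  (2 - 2 * cos u) * ((\sum_(j < N) cos (a + j%:R * u)) ^+ 2 +
    (\sum_(j < N) sin (a + j%:R * u)) ^+ 2) =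
  (cos (a + N%:R * u) - cos a) ^+ 2 + (sin (a + N%:R * u) - sin a) ^+ 2.
Proof.
set C := \sum_(j < N) cos _; set S := \sum_(j < N) sin _.
have e j : a + j.+1%:R * u = a + j%:R * u + u by rewrite -natr1; ring.
have e1 : (cos u - 1) * C - sin u * S = cos (a + N%:R * u) - cos a.
  have -> : cos (a + N%:R * u) - cos a =
      \sum_(j < N) (cos (a + j.+1%:R * u) - cos (a + j%:R * u)).
    rewrite -(big_mkord xpredT (fun j => cos (a + j.+1%:R * u) - cos (a + j%:R * u))).
    by rewrite telescope_sumr// mul0r addr0.
  rewrite !mulr_sumr -sumrB; apply: eq_bigr => j _.
  by rewrite e [cos (_ + u)]cosD; ring.
have e2 : sin u * C + (cos u - 1) * S = sin (a + N%:R * u) - sin a.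
  have -> : sin (a + N%:R * u) - sin a =
      \sum_(j < N) (sin (a + j.+1%:R * u) - sin (a + j%:R * u)).
    rewrite -(big_mkord xpredT (fun j => sin (a + j.+1%:R * u) - sin (a + j%:R * u))).
    by rewrite telescope_sumr// mul0r addr0.
  rewrite !mulr_sumr -big_split; apply: eq_bigr => j _ /=.
  by rewrite e [sin (_ + u)]sinD; ring.
rewrite -e1 -e2; have s2 := sin2cos2 u.
have -> : ((cos u - 1) * C - sin u * S) ^+ 2 + (sin u * C + (cos u - 1) * S) ^+ 2 =
  ((cos u - 1) ^+ 2 + sin u ^+ 2) * (C ^+ 2 + S ^+ 2) by ring.
by rewrite s2; ring.
Qed.

(** The nodes are N equidistant points on n full turns, and the common ratio is not
    1 because n < N. *)
Lemma sum_cos_grid (n N : nat) (x : R) : (0 < n < N)%N ->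
  \sum_(j < N) cos (x + j%:R * (n%:R * (2 * pi / N%:R))) = 0.
Proof.
move=> /andP[n0 nN]; set u := n%:R * _.
have NR0 : 0 < (N%:R : R) by rewrite ltr0n (leq_trans _ nN).
have uN : N%:R * u = pi *+ 2 *+ n.
  by rewrite /u -[pi *+ 2 *+ n]mulr_natl -[pi *+ 2]mulr_natl; field; rewrite gt_eqF.
have := cos_sin_sum_sqr x u N.
rewrite uN (periodicn (@cosD2pi R)) (periodicn (@sinD2pi R)) !subrr expr0n addr0.
move/eqP; rewrite mulf_eq0 => /orP[|].
  have h : 0 < u / 2 < pi.
    have pi0 := pi_gt0 R.
    have -> : u / 2 = n%:R / N%:R * pi by rewrite /u; field; rewrite gt_eqF.
    apply/andP; split; first by rewrite mulr_gt0// divr_gt0// ltr0n.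
    by rewrite gtr_pMl// ltr_pdivrMr// mul1r ltr_nat.
  have s0 := sin_gt0_pi h.
  have -> : cos u = 1 - 2 * sin (u / 2) ^+ 2.
    by rewrite [in LHS](splitr u) -mulr2n cos_mulr2n sin2cos2; ring.
  move/eqP => h1; have : 0 < sin (u / 2) ^+ 2 by exact: exprn_gt0.
  by move=> ?; exfalso; lra.
rewrite paddr_eq0 ?sqr_ge0// => /andP[]; rewrite sqrf_eq0 => /eqP -> _.
by [].
Qed.

Definition fejer_weight K n : R := (if n == 0%N then 1 else 2) * (1 - n%:R / K%:R).

Lemma fejer_weight_le2 K n : (n < K)%N -> `|fejer_weight K n| <= 2.
Proof.
move=> nK; have K0 : 0 < (K%:R : R) by rewrite ltr0n (leq_ltn_trans _ nK).
have h1 : 0 <= 1 - n%:R / K%:R :> R.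
  by rewrite subr_ge0 ler_pdivrMr// mul1r ler_nat ltnW.
have h2 : 1 - n%:R / K%:R <= 1 :> R by rewrite gerBl divr_ge0// ltW.
rewrite /fejer_weight normrM (ger0_norm h1) -[leRHS]mulr1.
by apply: ler_pM => //; case: ifP => _; rewrite ger0_norm// ler1n.
Qed.

Definition fejer K x : R := \sum_(n < K) fejer_weight K n * cos (n%:R * x).

(** The squared modulus of the Dirichlet sum; going from K to K + 1 adds
    1 + 2 (cos x + ... + cos (K x)) to both sides after multiplication by K. *)
Lemma fejerE K x : (0 < K)%N -> fejer K x = K%:R^-1 *
  ((\sum_(k < K) cos (k%:R * x)) ^+ 2 + (\sum_(k < K) sin (k%:R * x)) ^+ 2).
Proof.
move=> K0; have KR : (K%:R : R) != 0 by rewrite pnatr_eq0 -lt0n.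
apply: (mulfI KR); rewrite mulrA mulfV// mul1r.
pose b n : R := if n == 0%N then 1 else 2.
have -> : K%:R * fejer K x = \sum_(n < K) b n * (K%:R - n%:R) * cos (n%:R * x).
  rewrite mulr_sumr; apply: eq_bigr => n _; rewrite /fejer_weight -/(b n); field.
  exact: KR.
elim: K {K0 KR} => [|K IH]; first by rewrite !big_ord0 expr0n addr0.
have e : \sum_(n < K.+1) b n * (K.+1%:R - n%:R) * cos (n%:R * x) =
    \sum_(n < K) b n * (K%:R - n%:R) * cos (n%:R * x) +
    \sum_(n < K.+1) b n * cos (n%:R * x).
  rewrite big_ord_recr [in RHS]big_ord_recr /= addrA -big_split/=; congr (_ + _).
    by apply: eq_bigr => n _; rewrite -natr1; ring.
  by rewrite -natr1; ring.
rewrite e IH !big_ord_recr/=.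
set C := \sum_(k < K) cos _; set S := \sum_(k < K) sin _.
have -> : \sum_(i < K) b i * cos (i%:R * x) + b K * cos (K%:R * x) =
    1 + 2 * (C * cos (K%:R * x) + S * sin (K%:R * x)).
  rewrite -(big_ord_recr K (fun i : 'I_K.+1 => b i * cos (i%:R * x))) /=.
  rewrite big_ord_recl /= mul0r cos0 mulr1; congr (_ + _).
  rewrite (reindex_inj rev_ord_inj) /= !mulr_suml -big_split/= mulr_sumr.
  apply: eq_bigr => i _; rewrite /b /bump /= add1n; congr (_ * _).
  rewrite -[RHS](_ : cos (K%:R * x - i%:R * x) = _).
    by rewrite -mulrBl -subSn// subSS natrB// ltnW.
  by rewrite cosB; ring.
have := cos2Dsin2 (K%:R * x) => h.
have -> : (C + cos (K%:R * x)) ^+ 2 + (S + sin (K%:R * x)) ^+ 2 =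
  C ^+ 2 + S ^+ 2 + (cos (K%:R * x) ^+ 2 + sin (K%:R * x) ^+ 2 +
   2 * (C * cos (K%:R * x) + S * sin (K%:R * x))) by ring.
by rewrite h.
Qed.

Lemma fejer_ge0 K x : 0 <= fejer K x.
Proof.
case: K => [|K]; first by rewrite /fejer big_ord0.
by rewrite fejerE// mulr_ge0 ?invr_ge0// addr_ge0 ?sqr_ge0.
Qed.

(** The factor 1 - cos x cancels the denominator of the Fejer kernel and leaves
    (1 - cos (K x)) / K. *)
Lemma fejer_concentrated K x : fejer K x * (1 - cos x) <= 2 / K%:R.
Proof.
case: K => [|K]; first by rewrite /fejer big_ord0 mul0r mulr_ge0 ?invr_ge0.
rewrite fejerE// mulrAC [leRHS]mulrC -!mulrA ler_pM2l ?invr_gt0 ?ltr0n//.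
have := cos_sin_sum_sqr 0 x K.+1.
have e (g : R -> R) : \sum_(j < K.+1) g (0 + j%:R * x) = \sum_(j < K.+1) g (j%:R * x).
  by apply: eq_bigr => j _; rewrite add0r.
rewrite !e add0r cos0 sin0 subr0.
have -> : (cos (K.+1%:R * x) - 1) ^+ 2 + sin (K.+1%:R * x) ^+ 2 =
   2 - 2 * cos (K.+1%:R * x) by rewrite sin2cos2; ring.
have := cos_geN1 (K.+1%:R * x).
set T := _ ^+ 2 + _ ^+ 2 => h1 h2; lra.
Qed.

Lemma sum_fejer_grid K N th f0 : (0 < K <= N)%N ->
  \sum_(j < N) fejer K (th - (f0 + j%:R * (2 * pi / N%:R))) = N%:R.
Proof.
move=> /andP[K0 KN]; rewrite exchange_big/=.
rewrite (bigD1 (Ordinal K0))//= [X in _ + X]big1 ?addr0 => [|n n0].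
  rewrite (eq_bigr (fun=> 1)) ?sumr_const ?card_ord// => j _.
  by rewrite /fejer_weight /= !mul0r cos0 subr0 !mulr1.
rewrite -mulr_sumr -[RHS](mulr0 (fejer_weight K n)); congr (_ * _).
have n1 : (0 < n < N)%N.
  by rewrite lt0n (leq_trans (ltn_ord n) KN) andbT.
rewrite -[RHS](sum_cos_grid (n%:R * (f0 - th)) n1); apply: eq_bigr => j _.
by rewrite -cosN; congr cos; ring.
Qed.

(** The argument of Korovkin: the means are positive, reproduce constants, and are
    applied to a function that is controlled by 1 - cos. *)
Lemma fejer_mean_close K N th f0 (h : nat -> R) (y e C : R) : (0 < K <= N)%N -> 0 <= C ->
  (forall j, (j < N)%N ->
     `|y - h j| <= e + C * (1 - cos (th - (f0 + j%:R * (2 * pi / N%:R))))) ->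
  `|y - N%:R^-1 * \sum_(j < N) fejer K (th - (f0 + j%:R * (2 * pi / N%:R))) * h j|
    <= e + C * (2 / K%:R).
Proof.
move=> KN C0 H; have N0 : (0 < N)%N by case/andP: KN => a b; exact: leq_trans b.
have NR : 0 < (N%:R : R) by rewrite ltr0n.
set F := fun j : nat => fejer K (th - (f0 + j%:R * (2 * pi / N%:R))).
have -> : y - N%:R^-1 * \sum_(j < N) F j * h j =
    N%:R^-1 * \sum_(j < N) F j * (y - h j).
  rewrite [in RHS](eq_bigr (fun j : 'I_N => F j * y - F j * h j)); last by move=> j _; rewrite mulrBr.
  rewrite sumrB -mulr_suml sum_fejer_grid//; field; exact: lt0r_neq0.
rewrite normrM ger0_norm ?invr_ge0 ?(ltW NR)// ler_pdivrMl//.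
apply: (le_trans (ler_norm_sum _ _ _)).
apply: (@le_trans _ _ (\sum_(j < N) (F j * e + C * (2 / K%:R)))).
  apply: ler_sum => j _; rewrite normrM ger0_norm ?fejer_ge0//.
  apply: (le_trans (ler_wpM2l (fejer_ge0 _ _) (H j (ltn_ord j)))).
  rewrite mulrDr lerD2l mulrCA ler_wpM2l//; exact: fejer_concentrated.
rewrite big_split/= -mulr_suml sum_fejer_grid// sumr_const card_ord.
by rewrite -[X in _ + X <= _]mulr_natl mulrDr.
Qed.

(** The means at th and at -th are averaged, so that the sines cancel and a cosine
    polynomial in th remains; its coefficients are the discrete Fourier
    coefficients of h. *)
Lemma fejer_cosine_expansion K N th f0 (h : nat -> R) (y e C : R) :
  (0 < K <= N)%N -> 0 <= C ->
  (forall j, (j < N)%N -> let f := f0 + j%:R * (2 * pi / N%:R) in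
     `|y - h j| <= e + C * (1 - cos (th - f)) /\
     `|y - h j| <= e + C * (1 - cos (th + f))) ->
  `|y - \sum_(n < K) fejer_weight K n * cos (n%:R * th) *
      (N%:R^-1 * \sum_(j < N) cos (n%:R * (f0 + j%:R * (2 * pi / N%:R))) * h j)|
    <= e + C * (2 / K%:R).
Proof.
move=> KN C0 H.
have h1 := @fejer_mean_close K N th f0 h y e C KN C0 (fun j jN => (H j jN).1).
have h2 : `|y - N%:R^-1 * \sum_(j < N) fejer K (- th - (f0 + j%:R * (2 * pi / N%:R))) * h j|
    <= e + C * (2 / K%:R).
  apply: fejer_mean_close => // j jN; have [_] := H j jN.
  by rewrite -(cosN (th + _)) opprD.
pose f j : R := f0 + j%:R * (2 * pi / N%:R).
have E : \sum_(n < K) fejer_weight K n * cos (n%:R * th) *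
      (N%:R^-1 * \sum_(j < N) cos (n%:R * f j) * h j) =
  (N%:R^-1 * (\sum_(j < N) fejer K (th - f j) * h j) +
   N%:R^-1 * (\sum_(j < N) fejer K (- th - f j) * h j)) / 2.
  transitivity (N%:R^-1 * \sum_(j < N) \sum_(n < K)
      fejer_weight K n * cos (n%:R * th) * (cos (n%:R * f j) * h j)).
    rewrite exchange_big mulr_sumr; apply: eq_bigr => n _ /=.
    by rewrite mulrCA mulr_sumr.
  rewrite -mulrDr -mulrA; congr (_ * _).
  rewrite -big_split mulr_suml; apply: eq_bigr => j _ /=.
  rewrite -mulrDl /fejer -big_split/= mulrAC !mulr_suml; apply: eq_bigr => n _.
  have -> : cos (n%:R * (- th - f j)) = cos (n%:R * th + n%:R * f j).
    by rewrite -cosN; congr cos; ring.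
  by rewrite mulrBr cosB cosD; field.
rewrite E; move: h1 h2; rewrite -/(f _) !ler_norml.
set A := N%:R^-1 * _; set B := N%:R^-1 * _ => /andP[a1 a2] /andP[b1 b2].
apply/andP; split; lra.
Qed.

End Fejer.

(** * Equicontinuity and Fourier decay *)

Section CoreApproximation.
Variable R : realType.
Implicit Types (x s t L d : R) (n N K M : nat).

Lemma mulr_expRN_le1 x : 0 <= x -> x * expR (- x) <= 1.
Proof.
move=> x0; rewrite expRN ler_pdivrMr ?expR_gt0// mul1r.
by have := expR_ge1Dx x => ?; lra.
Qed.

(** The function v |-> e^{-e^v} is Lipschitz; this is stated for u and v whose
    logarithms are at distance at most d.  So e^{-tX} inherits a modulus of
    continuity from log X which is independent of t. *)
Lemma exp_log_lipschitz (u v d : R) : 0 <= u -> 0 <= v -> 0 <= d ->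
  u <= expR d * v -> v <= expR d * u -> `|expR (- u) - expR (- v)| <= expR d - 1.
Proof.
move=> u0 v0 d0 uv vu; have d1 : 0 <= expR d - 1.
  by have := expR_ge1Dx d => ?; lra.
have H (a b : R) : 0 <= a -> a <= b -> b <= expR d * a ->
    0 <= expR (- a) - expR (- b) <= expR d - 1.
  move=> a0 ab ba; rewrite subr_ge0 ler_expR lerN2 ab/=.
  have -> : expR (- b) = expR (- a) * expR (- (b - a)) by rewrite -expRD; congr expR; ring.
  have e0 := expR_ge0 (- a).
  have h1 : expR (- a) * (1 - (b - a)) <= expR (- a) * expR (- (b - a)).
    by rewrite ler_wpM2l// expR_ge1Dx.
  have h2 : expR (- a) * (b - a) <= expR (- a) * ((expR d - 1) * a).
    by rewrite ler_wpM2l//; lra.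
  have h3 := ler_wpM2l d1 (mulr_expRN_le1 a0).
  by lra.
have [h|h] := leP u v.
  by have /andP[h1 h2] := H _ _ u0 h vu; rewrite ger0_norm.
have /andP[h1 h2] := H _ _ v0 (ltW h) uv.
by rewrite distrC ger0_norm.
Qed.

Lemma cos_add_le_cos_sub (a b : R) : 0 <= a <= pi -> 0 <= b <= pi ->
  cos (a + b) <= cos (a - b).
Proof.
move=> /sin_ge0_pi sa /sin_ge0_pi sb; rewrite cosD cosB.
by have := mulr_ge0 sa sb => ?; lra.
Qed.

(** On [0, L] the distance between s and |s'| is controlled by the angle between
    w s and +- w s' as soon as w L = pi: below d0 the quantity is at most e
    anyway, and beyond d0 the gap 1 - cos is bounded away from 0. *)
Lemma modulus_le_1Bcos L (e : R) : 0 < L -> 0 < e ->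
  exists2 C, 0 <= C & forall s s' y, 0 <= s <= L -> - L <= s' <= L ->
    y <= expR `|s - `|s'| | - 1 -> y <= 1 ->
    y <= e + C * (1 - cos (pi / L * s - pi / L * s')) /\
    y <= e + C * (1 - cos (pi / L * s + pi / L * s')).
Proof.
move=> L0 e0; have pi0 := pi_gt0 R; have [w wE] : exists w, w = pi / L by exists (pi / L).
have w0 : 0 < w by rewrite wE divr_gt0.
have wge0 := ltW w0.
have wL : w * L = pi by rewrite wE divfK// gt_eqF.
rewrite -wE; have ln0 : 0 < ln (1 + e) by rewrite ln_gt0// ltrDl.
have [d0 [d00 d0L d0ln]] : exists d0, [/\ 0 < d0, d0 <= L & d0 <= ln (1 + e)].
  by exists (Num.min L (ln (1 + e))); rewrite lt_min L0 ln0 !ge_min !lexx orbT.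
have wd0 : 0 < w * d0 by rewrite mulr_gt0.
have wd0p : w * d0 <= pi by rewrite -wL ler_wpM2l.
have [k kE] : exists k, k = 1 - cos (w * d0) by exists (1 - cos (w * d0)).
have k0 : 0 < k.
  rewrite kE subr_gt0 -[ltRHS](@cos0 R) ltr_cos// in_itv/= ?lexx ?(ltW pi0)// wd0p.
  by rewrite ltW.
have ed0 : expR d0 - 1 <= e.
  rewrite lerBlDl -[leRHS]lnK ?ler_expR// posrE; exact: addr_gt0.
exists k^-1; first by rewrite invr_ge0 ltW.
move=> s s' y sL s'L; have s'0 : 0 <= `|s'| <= L by rewrite normr_ge0 ler_norml.
have [d dE] : exists d, d = `|s - `|s'| | by exists `|s - `|s'| |.
rewrite -dE => y_le y_le1.
have dL : d <= L.
  rewrite dE ler_norml; case/andP: s'0 sL => a1 a2 /andP[b1 b2].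
  by clear -a1 a2 b1 b2; apply/andP; split; lra.
have d_ge0 : 0 <= d by rewrite dE.
have main z : cos z <= cos (w * d) -> y <= e + k^-1 * (1 - cos z).
  move=> cz; have z0 : 0 <= 1 - cos z by rewrite subr_ge0 cos_le1.
  have [dd|dd] := leP d d0.
    rewrite (le_trans y_le)// (le_trans (lerB _ (lexx 1)) (le_trans ed0 _)) ?ler_expR//.
    by rewrite lerDl mulr_ge0// invr_ge0 ltW.
  apply: (le_trans y_le1); apply: (@le_trans _ _ (k^-1 * (1 - cos z))).
    rewrite ler_pdivlMl// mulr1 kE lerD2l lerN2 (le_trans cz)// ltW//.
    rewrite ltr_cos ?in_itv/= ?ltr_pM2l ?(ltW wd0)//.
    by rewrite -wL mulr_ge0//= ler_wpM2l.
  by rewrite lerDr ltW.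
have wd : cos (w * d) = cos (w * s - w * `|s'|).
  rewrite dE; have [h0|h0] := leP 0 (s - `|s'|); first by rewrite ger0_norm// mulrBr.
  by rewrite ltr0_norm// -cosN mulrN opprK mulrBr.
have wp u : 0 <= u <= L -> 0 <= w * u <= pi.
  by move=> /andP[u0 uL]; rewrite mulr_ge0//= -wL ler_wpM2l.
have := cos_add_le_cos_sub (wp _ sL) (wp _ s'0); rewrite -wd => c1.
split; apply: main; have [p|p] := leP 0 s'.
- by rewrite wd ger0_norm.
- by apply: le_trans c1; rewrite ltr0_norm// mulrN.
- by apply: le_trans c1; rewrite ger0_norm.
- by rewrite wd ltr0_norm// mulrN opprK.
Qed.

(** The family e^{-t X} is equicontinuous in t and in the number of terms of X,
    because log X is 1-Lipschitz; the modulus is in the form that the Fejer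
    kernel needs. *)
Lemma exp_sechr_sum_modulus L (e : R) : 0 < L -> 0 < e ->
  exists2 C, 0 <= C & forall M t s s', 0 <= t -> 0 <= s <= L -> - L <= s' <= L ->
    let h x := expR (- (t * sechr_sum L M x)) in
    `|h s - h s'| <= e + C * (1 - cos (pi / L * s - pi / L * s')) /\
    `|h s - h s'| <= e + C * (1 - cos (pi / L * s + pi / L * s')).
Proof.
move=> L0 e0; have [C C0 HC] := modulus_le_1Bcos L0 e0; exists C => //.
move=> M t s s' t0 sL s'L h.
have tT y : 0 <= t * sechr_sum L M y.
  by apply: mulr_ge0 => //; apply: ltW; exact: sechr_sum_gt0.
apply: HC => //.
  rewrite /h -(sechr_sum_norm L M s'); apply: exp_log_lipschitz => //.
    by rewrite mulrCA; apply: ler_wpM2l => //; exact: sechr_sum_log.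
  by rewrite mulrCA distrC; apply: ler_wpM2l => //; exact: sechr_sum_log.
have b y : 0 <= h y <= 1 by rewrite expR_ge0 expR_le1 oppr_le0 tT.
move: (b s) (b s') => /andP[a1 a2] /andP[b1 b2].
by rewrite ler_norml; apply/andP; split; move: (h s) (h s') a1 a2 b1 b2 => *; lra.
Qed.

(** The modes have exact period 2 L, so the mismatch at the two ends of a row comes
    from e^{-tX} alone. *)
Lemma cexp_i_periodic L n z : 0 < L ->
  cexp (- (0 +i* (n%:R * (pi / L))) * (z + (2 * L)%:C)) =
  cexp (- (0 +i* (n%:R * (pi / L))) * z).
Proof.
move=> L0; rewrite mulrDr cexpD -[RHS]mulr1; congr (_ * _).
rewrite /cexp /=.
have -> : - 0 * (2 * L) - - (n%:R * (pi / L)) * 0 = 0 by ring.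
have -> : - 0 * 0 + - (n%:R * (pi / L)) * (2 * L) = - (pi *+ 2 *+ n).
  rewrite -[pi *+ 2 *+ n]mulr_natl -[pi *+ 2]mulr_natl; field; exact: lt0r_neq0.
rewrite expR0 cosN sinN -[pi *+ 2 *+ n]add0r.
by rewrite (periodicn (@cosD2pi R)) (periodicn (@sinD2pi R)) cos0 sin0 oppr0 mulr1.
Qed.

(** The grid average is moved from the real axis to the height -eta, where the
    n-th mode has modulus e^{-n pi eta/L} and e^{-tX} is still at most 1.  The
    number of terms M comes first and makes the vertical sides nearly cancel; the
    number of nodes N depends on M, since the Taylor constants do.  Both serve
    all t >= 0 and all n < K. *)
Lemma fourier_coeff_decay L (eta e : R) K : 0 < L -> 0 < eta -> eta < pi / 2 -> 0 < e ->
  exists M N, [/\ (0 < M)%N, (K <= N)%N, (0 < N)%N & forall n t, (n < K)%N -> 0 <= t ->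
   `|N%:R^-1 * \sum_(j < N) cos (n%:R * (- pi + j%:R * (2 * pi / N%:R))) *
      expR (- (t * sechr_sum L M (- L + j%:R * (2 * L / N%:R))))|
   <= expR (- (pi / L * eta)) ^+ n + e].
Proof.
move=> L0 eta0 etapi e0; have pi0 := pi_gt0 R.
pose w := pi / L; have w0 : 0 < w by rewrite divr_gt0.
have Lge0 := ltW L0; have ege0 := ltW eta0; have wge0 := ltW w0.
pose c := cos eta; have c0 : 0 < c.
  by rewrite cos_gt0_pihalf// etapi andbT (lt_trans _ eta0)// oppr_lt0 divr_gt0.
pose p := c / expR L; have p0 : 0 < p by rewrite divr_gt0// expR_gt0.
have [Cp [gp [Cp0 Hp]]] := unif_taylor_expt p0.
pose S (z : R[i]) := [/\ `|complex.Re z| <= L, - eta <= complex.Im z & complex.Im z <= 0].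
have S_bound z : S z -> normc z <= L + eta.
  move=> [h1 h2 h3]; apply: (le_trans (normc_le_ReIm _)); rewrite lerD// ler0_norm//; lra.
have S_cos z : S z -> c <= cos (complex.Im z).
  move=> [_ h2 h3]; rewrite /c -(cosN (complex.Im z)) leNgt ltr_cos.
  - by rewrite -leNgt; lra.
  - by rewrite in_itv/=; apply/andP; split; lra.
  - by rewrite in_itv/=; apply/andP; split; lra.
have S_Re M z : S z -> p <= complex.Re (sech_sum L M z).
  move=> Sz; have cz := S_cos _ Sz; have [h1 _ _] := Sz.
  apply: le_trans (Re_sech_sum_ge _ _ _); last exact: le_trans (ltW c0) cz.
  apply: ler_pM; rewrite ?(ltW c0) ?invr_ge0 ?expR_ge0//.
  rewrite lef_pV2 ?posrE ?coshr_gt0 ?expR_gt0//.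
  apply: (le_trans (coshr_le_expR _ 0)); rewrite subr0 /coshr oppr0 expR0.
  by rewrite -(natrD _ 1 1) mulfV// mulr1 ler_expR.
(* A / (2 M + 1) is the contribution of the mismatch at the ends of the rows. *)
pose A := eta / (2 * L) * (2 * Cp) * (4 / L); have A0 : 0 <= A.
  by rewrite !mulr_ge0 ?invr_ge0 ?mulr_ge0.
pose M := (Num.bound (A / (e / 2))).+1.
have AM : A / (2 * M%:R + 1) <= e / 2.
  have := archi_boundP (mulr_ge0 A0 (_ : 0 <= (e / 2)^-1)).
  rewrite invr_ge0 ltW ?divr_gt0// => /(_ isT).
  rewrite ltr_pdivrMr ?divr_gt0// -/M => h.
  have Mb : (Num.bound (A / (e / 2)))%:R <= (M%:R : R) by rewrite ler_nat leqnSn.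
  have M0 : 0 <= (M%:R : R) by [].
  rewrite ler_pdivrMr; last lra.
  nra.
pose D (i : R * 'I_K) z := 0 <= i.1 /\ S z.
pose g (i : R * 'I_K) z := cexp (- (i.1)%:C * sech_sum L M z) *
   cexp (- (0 +i* (i.2%:R * w)) * z).
have Re_lin (n : nat) z : S z -> complex.Re (- (0 +i* (n%:R * w)) * z) <= 0.
  case: z => x y [_ _ /= h].
  have := mulr_ge0 (mulr_ge0 (ler0n R n) (ltW w0)) (_ : 0 <= - y).
  by rewrite oppr_ge0 h => /(_ isT) ?; lra.
have g_taylor : unif_taylor D g.
  apply: unif_taylorM.
    apply: (@unif_taylor_comp _ _ D (fun i z => 0 <= i.1 /\ p <= complex.Re z)
      (fun _ z => sech_sum L M z) (fun i z => cexp (- (i.1)%:C * z))).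
    - by move=> i z [h1 h2]; split=> //; exact: S_Re.
    - apply: (unif_taylor_sech_sum (B := L + eta) L M c0) => i z [_ h]; split.
        exact: S_bound.
      exact: S_cos.
    - exact: (unif_taylor_index (f := fst) _ (unif_taylor_expt p0)).
  apply: (@unif_taylor_comp _ _ D (fun _ z => complex.Re z <= 0)
    (fun i z => - (0 +i* (i.2%:R * w)) * z) (fun _ => @cexp R)).
  - by move=> i z [_ h]; exact: Re_lin.
  - apply: (@unif_taylor_scale _ _ D _ (L + eta + K%:R * w)).
    + by rewrite !addr_ge0// mulr_ge0.
    + move=> i z [_ h]; apply: (le_trans (S_bound _ h)).
      by rewrite lerDl mulr_ge0.
    + move=> i; rewrite normcN; apply: (le_trans (normc_le_ReIm _)).
      rewrite /= normr0 add0r ger0_norm; last by rewrite mulr_ge0.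
      apply: (@le_trans _ _ (K%:R * w)); last by rewrite lerDr addr_ge0.
      by rewrite ler_wpM2r ?(ltW w0)// ler_nat ltnW.
  - exact: (@unif_taylor_cexp _ _ _ 0).
have [C [g' [C0 Hg]]] := g_taylor.
(* B / N is the contribution of the second-order errors of the Taylor bounds. *)
pose B := C * eta * (2 * L + eta); have B0 : 0 <= B.
  by rewrite !mulr_ge0// addr_ge0// mulr_ge0.
pose N := maxn K (Num.bound (B / (e / 2))).+1.
have N0 : (0 < N)%N by rewrite leq_max orbT.
have NR : 0 < (N%:R : R) by rewrite ltr0n.
have BN : B / N%:R <= e / 2.
  have := archi_boundP (mulr_ge0 B0 (_ : 0 <= (e / 2)^-1)).
  rewrite invr_ge0 ltW ?divr_gt0// => /(_ isT).
  rewrite ltr_pdivrMr ?divr_gt0// => h.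
  have Nb : (Num.bound (B / (e / 2)))%:R <= (N%:R : R).
    by rewrite ler_nat (leq_trans (leqnSn _))// leq_maxr.
  rewrite ler_pdivrMr//; nra.
exists M, N; split=> //; first exact: leq_maxl.
move=> n t nK t0; pose i : R * 'I_K := (t, Ordinal nK).
pose pt (j k : nat) : R[i] := (- L)%:C + (j%:R / N%:R) * (2 * L)%:C +
   (k%:R / N%:R) * (0 +i* (- eta)).
(* The height decreases from 0 to -eta, where the modes are damped. *)
have ptE j k : pt j k = (- L + j%:R * (2 * L / N%:R)) +i* (- (k%:R / N%:R * eta)).
  rewrite /pt -!(rmorph_nat (real_complex R)) -!fmorphV -!rmorphM /=; simpc.
  by congr (_ +i* _); ring.
have ptS j k : (j <= N)%N -> (k <= N)%N -> S (pt j k).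
  move=> jN kN; rewrite ptE; have fr (m : nat) : (m <= N)%N -> 0 <= (m%:R / N%:R : R) <= 1.
    move=> mN; apply/andP; split; first exact: divr_ge0.
    by rewrite ler_pdivrMr// mul1r ler_nat.
  have /andP[a1 a2] := fr j jN; have /andP[b1 b2] := fr k kN.
  have -> : j%:R * (2 * L / N%:R) = j%:R / N%:R * (2 * L) by ring.
  split=> /=; last by rewrite oppr_le0 mulr_ge0.
    by rewrite ler_norml; apply/andP; split; nra.
  by rewrite lerN2 ler_piMl.
have mis k : (k < N)%N -> normc (g i (pt N k) - g i (pt 0%N k)) <=
    2 * Cp * (4 / ((2 * M%:R + 1) * L)).
  move=> kN; have e1 : pt N k = pt 0%N k + (2 * L)%:C.
    by rewrite !ptE; simpc; congr (_ +i* _); field; rewrite gt_eqF.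
  have S0 : S (pt 0%N k) by apply: ptS => //; exact: ltnW.
  have S1 : S (pt N k) by apply: ptS => //; exact: ltnW.
  rewrite e1 /g cexp_i_periodic// -mulrBl normcM normc_cexp -e1.
  rewrite -[leRHS]mulr1; apply: ler_pM; rewrite ?normc_ge0 ?expR_ge0//; last first.
    by rewrite expR_le1; exact: Re_lin.
  apply: (le_trans (taylor_lipschitz (Hp t) _ _)); [by split=> //; exact: S_Re..|].
  rewrite ler_wpM2l ?mulr_ge0// e1; apply: sech_sum_mismatch => //.
  by rewrite ptE /= mul0r addr0.
have L2n : normc ((2 * L)%:C : R[i]) = 2 * L by rewrite normc_real ger0_norm// mulr_ge0.
have etan : normc (0 +i* (- eta) : R[i]) = eta.
  by rewrite /= expr0n add0r sqrrN sqrtr_sqr gtr0_norm.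
have shift := @contour_shift R C _ S (g i) (g' i) N (- L)%:C (2 * L)%:C (0 +i* (- eta))
  N0 _ C0 _ ptS mis.
rewrite L2n etan in shift.
have L2 : ((2 * L)%:C : R[i]) != 0.
  by apply/eqP => /(congr1 (@complex.Re R)) /= h; have := mulr_gt0 (ltr0Sn R 1) L0; rewrite h ltxx.
have {shift}/(_ L2) shift := shift.
have tb : taylor_bound C S (g i) (g' i).
  by move=> z w' Sz Sw; apply: Hg; split.
have {shift}/(_ tb) shift := shift.
have top j : (j < N)%N -> normc (g i (pt j N)) <= expR (- (w * eta)) ^+ n.
  move=> jN; have Sj : S (pt j N) by apply: ptS => //; exact: ltnW.
  rewrite /g normcM !normc_cexp -[leRHS]mul1r; apply: ler_pM; rewrite ?expR_ge0//.
    rewrite expR_le1.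
    have := S_Re M _ Sj; case: (sech_sum L M (pt j N)) => a b /= pa.
    by have := mulr_ge0 t0 (le_trans (ltW p0) pa) => ?; lra.
  rewrite ptE /= -expRM_natl ler_expR le_eqVlt; apply/orP; left; apply/eqP.
  by field; rewrite gt_eqF.
have bot j : cos (n%:R * (- pi + j%:R * (2 * pi / N%:R))) *
      expR (- (t * sechr_sum L M (- L + j%:R * (2 * L / N%:R)))) =
    complex.Re (g i (pt j 0%N)).
  have -> : pt j 0%N = (- L + j%:R * (2 * L / N%:R))%:C.
    by rewrite ptE !mul0r oppr0.
  rewrite /g sech_sum_real -rmorphN -rmorphM cexp_real /cexp /=.
  set x := - L + _.
  have -> : - 0 * x - - (n%:R * w) * 0 = 0 by ring.
  have -> : - 0 * 0 + - (n%:R * w) * x = - (n%:R * (- pi + j%:R * (2 * pi / N%:R))).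
    by rewrite /x /w; field; rewrite !gt_eqF.
  rewrite expR0 cosN mulNr; simpc; ring.
have ReSum (F : 'I_N -> R[i]) : \sum_(j < N) complex.Re (F j) = complex.Re (\sum_(j < N) F j).
  by apply/esym/big_morph => // [[? ?] [? ?]].
rewrite (eq_bigr _ (fun (j : 'I_N) _ => bot j)) ReSum.
rewrite normrM ger0_norm ?invr_ge0 ?(ltW NR)// ler_pdivrMl//.
apply: (le_trans (normc_Re _)).
rewrite normcB in shift.
have := le_normcD (\sum_(j < N) g i (pt j 0%N) - \sum_(j < N) g i (pt j N))
  (\sum_(j < N) g i (pt j N)).
rewrite subrK => h; apply: (le_trans h); rewrite mulrDr addrC; apply: lerD.
  apply: (le_trans (le_normc_sum _ _ _)).
  apply: (@le_trans _ _ (\sum_(j < N) expR (- (w * eta)) ^+ n)).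
    by apply: ler_sum => j _; exact: top.
  by rewrite sumr_const card_ord -[leLHS]mulr_natl.
apply: (le_trans shift); rewrite (splitr e) [leRHS]mulrDr; apply: lerD.
  rewrite ler_wpM2l ?(ltW NR)//; apply: le_trans AM.
  rewrite le_eqVlt; apply/orP; left; apply/eqP; rewrite /A; field.
  by rewrite !gt_eqF// ltr_wpDl// mulr_ge0.
by rewrite -/B mulrC -ler_pdivrMr.
Qed.

End CoreApproximation.

(** * Separable approximation of the Laplace kernel *)

Section KernelApproximation.
Variable R : realType.

Lemma sum_geometric_tail (r : R) (l K : nat) : 0 <= r < 1 ->
  \sum_(l <= n < K) r ^+ n <= r ^+ l / (1 - r).
Proof.
move=> /andP[r0 r1]; have r1' : 0 < 1 - r by rewrite subr_gt0.
have [lK|lK] := leqP l K; last first.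
  by rewrite big_geq ?(ltnW lK)// divr_ge0 ?exprn_ge0// ltW.
rewrite ler_pdivlMr// mulr_suml.
rewrite (eq_bigr (fun n => - (r ^+ n.+1 - r ^+ n))) => [|n _].
  by rewrite sumrN telescope_sumr// opprB gerBl exprn_ge0.
by rewrite exprS; ring.
Qed.

(** The Fejer mean of e^{-tX} is a cosine polynomial of degree less than K; the
    terms of degree at least l are small by the decay of the coefficients.  The
    parameters are fixed in the order K (equicontinuity), M, N (decay). *)
Lemma periodic_approx (L eta e : R) (l : nat) (r := expR (- (pi / L * eta))) :
  0 < L -> 0 < eta -> eta < pi / 2 -> 0 < e ->
  exists M N (q : nat -> nat -> R), (0 < M)%N /\ forall t s, 0 <= t -> 0 <= s <= L ->
    `|expR (- (t * sechr_sum L M s)) - \sum_(n < l) cos (n%:R * (pi / L * s)) *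
        \sum_(j < N) q n j * expR (- (t * sechr_sum L M (- L + j%:R * (2 * L / N%:R))))|
    <= 2 * (r ^+ l / (1 - r)) + e.
Proof.
move=> L0 eta0 etapi e0; have pi0 := pi_gt0 R.
have e4 : 0 < e / 4 by rewrite divr_gt0.
have [C C0 HC] := exp_sechr_sum_modulus L0 e4.
pose K := maxn l (Num.bound (2 * C / (e / 4))).+1.
have K0 : (0 < K)%N by rewrite leq_max orbT.
have KR : 0 < (K%:R : R) by rewrite ltr0n.
have lK : (l <= K)%N by exact: leq_maxl.
have CK : C * (2 / K%:R) <= e / 4.
  have := archi_boundP (mulr_ge0 (mulr_ge0 (ler0n R 2) C0) (_ : 0 <= (e / 4)^-1)).
  rewrite invr_ge0 (ltW e4) => /(_ isT); rewrite ltr_pdivrMr// => h.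
  have Kb : (Num.bound (2 * C / (e / 4)))%:R <= (K%:R : R).
    by rewrite ler_nat (leq_trans (leqnSn _))// leq_maxr.
  have -> : C * (2 / K%:R) = 2 * C / K%:R by ring.
  rewrite ler_pdivrMr//; nra.
have e4K : 0 < e / 4 / K%:R by rewrite divr_gt0.
have [M [N [M0 KN N0 decay]]] := fourier_coeff_decay K L0 eta0 etapi e4K.
have NR : 0 < (N%:R : R) by rewrite ltr0n.
pose f j : R := - pi + j%:R * (2 * pi / N%:R).
pose s_ j : R := - L + j%:R * (2 * L / N%:R).
have fE j : f j = pi / L * s_ j by rewrite /f /s_; field; rewrite !gt_eqF.
exists M, N, (fun n j => fejer_weight R K n * (N%:R^-1 * cos (n%:R * f j))).
split=> // t s t0 sL.
pose h j := expR (- (t * sechr_sum L M (s_ j))).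
pose c n := N%:R^-1 * \sum_(j < N) cos (n%:R * f j) * h j.
have KN0 : (0 < K <= N)%N by rewrite K0.
have s_L j : (j < N)%N -> - L <= s_ j <= L.
  move=> jN; have j1 : 0 <= (j%:R / N%:R : R) by exact: divr_ge0.
  have j2 : (j%:R / N%:R : R) <= 1 by rewrite ler_pdivrMr// mul1r ler_nat ltnW.
  have -> : s_ j = - L + j%:R / N%:R * (2 * L) by rewrite /s_; ring.
  by apply/andP; split; nra.
have : `|expR (- (t * sechr_sum L M s)) -
    \sum_(n < K) fejer_weight R K n * cos (n%:R * (pi / L * s)) * c n| <= e / 4 + C * (2 / K%:R).
  apply: fejer_cosine_expansion => // j jN /=; rewrite -/(f j) fE.
  by apply: HC => //; exact: s_L.
set y := expR _ => close.
have -> : \sum_(n < l) cos (n%:R * (pi / L * s)) * \sum_(j < N)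
      fejer_weight R K n * (N%:R^-1 * cos (n%:R * f j)) * h j =
   \sum_(n < l) fejer_weight R K n * cos (n%:R * (pi / L * s)) * c n.
  apply: eq_bigr => n _; rewrite /c mulr_sumr -[in RHS]mulrA !mulr_sumr.
  by apply: eq_bigr => j _; ring.
rewrite -(big_mkord xpredT (fun n => fejer_weight R K n * cos (n%:R * (pi / L * s)) * c n)).
move: close; rewrite -(big_mkord xpredT (fun n => fejer_weight R K n * cos (n%:R * (pi / L * s)) * c n)).
rewrite (@big_cat_nat _ _ _ l 0%N K)//=.
set A := \sum_(0 <= n < l) _; set B := \sum_(l <= n < K) _ => close.
have r0 : 0 < r by exact: expR_gt0.
have r1 : r < 1 by rewrite expR_lt1 oppr_lt0 mulr_gt0// divr_gt0.
have tail : `|B| <= 2 * (r ^+ l / (1 - r)) + e / 2.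
  apply: (le_trans (ler_norm_sum _ _ _)).
  apply: (@le_trans _ _ (\sum_(l <= n < K) (2 * r ^+ n + 2 * (e / 4 / K%:R)))).
    rewrite big_nat [leRHS]big_nat; apply: ler_sum => n /andP[_ nK].
    rewrite -mulrDr normrM; apply: ler_pM => //; last exact: decay.
    rewrite normrM -[leRHS]mulr1; apply: ler_pM => //; last exact: cos_max.
    exact: fejer_weight_le2.
  rewrite big_split/= -mulr_sumr; apply: lerD.
    by rewrite ler_wpM2l//; apply: sum_geometric_tail; rewrite (ltW r0).
  rewrite sumr_const_nat -[leLHS]mulr_natl.
  apply: (@le_trans _ _ (K%:R * (2 * (e / 4 / K%:R)))).
    by rewrite ler_wpM2r ?ler_nat ?leq_subr// mulr_ge0// ltW.
  by rewrite le_eqVlt; apply/orP; left; apply/eqP; field; rewrite gt_eqF.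
have -> : y - A = (y - (A + B)) + B by ring.
apply: (le_trans (ler_normD _ _)); lra.
Qed.

(** Since 4 l^2 >= 4 > pi, the argument of the logarithm in gamma is at least the
    square root of 4 k. *)
Lemma gammac_lower (l : nat) (k : R) : (1 <= l)%N -> 1 <= k ->
  223 / 100 + ln (4 * k) / pi <= gammac l k.
Proof.
move=> l1 k1; have pi0 := pi_gt0 R; rewrite /gammac lerD2l.
have k4 : 0 < 4 * k by lra.
have -> : ln (4 * k) / pi = 2 / pi * ln (Num.sqrt (4 * k)).
  rewrite -[in LHS](sqr_sqrtr (ltW k4)) lnXn ?sqrtr_gt0//.
  by rewrite -mulr_natl; ring.
rewrite ler_wpM2l ?divr_ge0 ?(ltW pi0)// ler_ln ?posrE ?sqrtr_gt0//; last first.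
  by rewrite !mulr_gt0 ?ltr0n// sqrtr_gt0 divr_gt0//; lra.
have lR : 1 <= (l%:R : R) by rewrite ler1n.
rewrite -[leRHS]ger0_norm; last by rewrite !mulr_ge0 ?sqrtr_ge0.
rewrite -sqrtr_sqr ler_sqrt ?sqr_ge0// exprMn sqr_sqrtr; last by rewrite divr_ge0 ?(ltW pi0)//; lra.
rewrite mulrA ler_pdivlMr// exprMn.
have := pihalf_lt2 R; have l2 : 1 <= (l%:R : R) ^+ 2 by rewrite exprn_ege1.
move: ((l%:R : R) ^+ 2) l2 => m m1; rewrite ltr_pdivrMr// => p4.
have h1 : k * pi <= k * 4 by rewrite ler_wpM2l//; lra.
have h2 : k <= m * k by rewrite ler_peMl//; lra.
nra.
Qed.

Lemma gammac_ge0 (l : nat) (k : R) : (1 <= l)%N -> 1 <= k -> 0 <= gammac l k.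
Proof.
move=> l1 k1; apply: le_trans (gammac_lower l1 k1).
by rewrite addr_ge0// divr_ge0 ?pi_ge0// ln_ge0//; lra.
Qed.

(** The decay rate e^{-pi eta/L} is available for eta < pi/2 only; this provides a
    rate r slightly above the limit r0 that costs a factor 2 in r^l and another
    factor 2 in the sum of the geometric series, whatever l is. *)
Lemma enlarge_radius (r0 : R) (l : nat) : (1 <= l)%N -> 0 < r0 -> r0 < 1 ->
  exists r, [/\ r0 < r, r < 1, r ^+ l <= 2 * r0 ^+ l &
    (1 - r)^-1 <= 2 * (1 - r0)^-1].
Proof.
move=> l1 r00 r01; have lR : 1 <= (l%:R : R) by rewrite ler1n.
have l0 : 0 < (l%:R : R) by exact: lt_le_trans lR.
pose de := (1 - r0) / (2 * l%:R).
have de0 : 0 < de by rewrite divr_gt0 ?subr_gt0// mulr_gt0.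
have de_l : l%:R * de = (1 - r0) / 2 by rewrite /de; field; rewrite gt_eqF.
have de_le : de <= (1 - r0) / 2 by rewrite -de_l ler_peMl// ltW.
have rde : r0 * de <= de by rewrite ler_piMl// ltW.
exists (r0 * (1 + de)); split.
- by rewrite ltr_pMr// ltrDl.
- by rewrite mulrDr mulr1; clear -rde de_le r01; lra.
- rewrite exprMn mulrC ler_wpM2r ?exprn_ge0 ?(ltW r00)//.
  apply: (@le_trans _ _ (expR de ^+ l)).
    by rewrite lerXn2r ?nnegrE ?expR_ge0 ?expR_ge1Dx// addr_ge0// ltW.
  rewrite -expRM_natl de_l.
  have h : `|(1 - r0) / 2| <= 1 / 2 by rewrite ler_norml; apply/andP; split; lra.
  by have := expR_le_quad h; clear -r00 r01 => ?; nra.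
have -> : 2 * (1 - r0)^-1 = ((1 - r0) / 2)^-1 by rewrite invf_div.
by rewrite lef_pV2 ?posrE ?mulrDr ?mulr1; clear -rde de_le r01; lra.
Qed.

Lemma inv_1BexpRN (s : R) : 0 < s -> (1 - expR (- s))^-1 <= 1 + s^-1.
Proof.
move=> s0; have e1 : 0 < 1 - expR (- s) by rewrite subr_gt0 expR_lt1 oppr_lt0.
have h1 : (1 + s) * expR (- s) <= 1.
  by rewrite expRN ler_pdivrMr ?expR_gt0// mul1r expR_ge1Dx.
rewrite -[leLHS]div1r ler_pdivrMr//.
have -> : 1 + s^-1 = (1 + s) / s by field; rewrite gt_eqF.
by rewrite mulrAC ler_pdivlMr//; lra.
Qed.

(** The interval [a, b] is parametrized by x = c X(s) with 0 <= s <= L, and p_n(x)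
    is the cosine of n pi s/L; the exponents sg_j are the values of c X at the grid
    points.  With r0 = rho^{1/2} the total error is at most
    (1 + 8 / (1 - r0)) r0^l, and 1 / (1 - r0) <= 1 + L/pi, so that it is below
    16 gamma r0^l. *)
Lemma laplace_kernel_approx (a b : R) (l : nat) : 0 < a -> a < b -> (1 <= l)%N ->
  exists N (sg : nat -> R) (p : nat -> R -> R) (q : nat -> nat -> R),
    (forall j, 0 < sg j) /\ forall x t, a <= x <= b -> 0 <= t ->
    `|expR (- (t * x)) - \sum_(n < l) p n x * \sum_(j < N) q n j * expR (- (t * sg j))|
    <= 16 * gammac l (b / a) * rho a b `^ (l%:R / 2).
Proof.
move=> a0 ab l1; have pi0 := pi_gt0 R; have b0 : 0 < b by exact: lt_trans ab.
pose k := b / a; have k1 : 1 <= k by rewrite ler_pdivlMr// mul1r ltW.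
have kp : 0 < k by lra.
pose L := ln (4 * k); have L0 : 0 < L by rewrite ln_gt0//; lra.
pose s0 := pi ^+ 2 / (2 * L); have s00 : 0 < s0 by rewrite divr_gt0 ?exprn_gt0// mulr_gt0.
pose r0 := expR (- s0).
have r00 : 0 < r0 by exact: expR_gt0.
have r01 : r0 < 1 by rewrite expR_lt1 oppr_lt0.
have lR : 1 <= (l%:R : R) by rewrite ler1n.
have rhoE : rho a b `^ (l%:R / 2) = r0 ^+ l.
  rewrite /rho /powR gt_eqF ?expR_gt0// expRK -expRM_natl; congr expR.
  rewrite -[4 * b / a]mulrA -/k -/L /s0; field; exact: lt0r_neq0.
have [r [r_gt r1 rl inv1]] := enlarge_radius l1 r00 r01.
pose eta := - (L / pi * ln r).
have rp : 0 < r by exact: lt_trans r_gt.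
have eta_r : expR (- (pi / L * eta)) = r.
  have -> : - (pi / L * eta) = ln r.
    have := lt0r_neq0 pi0; rewrite /eta; move: (pi : R) => p' p'0.
    by field; rewrite p'0 gt_eqF.
  by rewrite lnK.
have Lpi : 0 < L / pi by rewrite divr_gt0.
have eta0 : 0 < eta by rewrite oppr_gt0 pmulr_rlt0// ln_lt0// rp r1.
have etapi : eta < pi / 2.
  have : ln r0 < ln r by rewrite ltr_ln.
  rewrite expRK => h; have -> : pi / 2 = L / pi * s0.
    have := lt0r_neq0 pi0; rewrite /s0; move: (pi : R) => p' p'0.
    by field; rewrite p'0 gt_eqF.
  by rewrite /eta -mulrN ltr_pM2l// ltrNl.
(* The choice eta = - (L / pi) ln r makes e^{-pi eta/L} equal to r. *)
have e0 : 0 < r0 ^+ l by exact: exprn_gt0.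
have [M [N [q [M0 H]]]] := periodic_approx l L0 eta0 etapi e0.
rewrite eta_r in H.
pose c := b / sechr_sum L M 0.
have T0 x : 0 < sechr_sum L M x := sechr_sum_gt0 _ _ _.
have c0 : 0 < c by rewrite divr_gt0.
have cT0 : c * sechr_sum L M 0 = b by rewrite /c divfK// gt_eqF.
have cTL : c * sechr_sum L M L <= a.
  have := ler_wpM2l (ltW c0) (sechr_sum_ratio k1 M0); rewrite -/L cT0 mulrCA.
  have -> : b = k * a by rewrite /k divfK// gt_eqF.
  by rewrite ler_pM2l.
have /choice[s hs] : forall x, exists s, a <= x <= b ->
    0 <= s <= L /\ c * sechr_sum L M s = x.
  move=> x; have [xab|] := boolP (a <= x <= b); last by exists 0.
  case/andP: (xab) => ax xb.
  have [|s sL sx] := @sechr_sum_onto R L M (x / c) (ltW L0).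
    by rewrite ler_pdivlMr// ler_pdivrMr// ![_ * c]mulrC cT0 xb (le_trans cTL).
  by exists s => _; split=> //; rewrite sx mulrC divfK// gt_eqF.
exists N, (fun j => c * sechr_sum L M (- L + j%:R * (2 * L / N%:R))),
  (fun n x => cos (n%:R * (pi / L * s x))), q.
split=> [j|x t xab t0]; first exact: mulr_gt0.
have [sL sx] := hs x xab.
have := H (t * c) (s x) (mulr_ge0 t0 (ltW c0)) sL.
rewrite -[t * c * _]mulrA sx.
under [X in `|_ - X|]eq_bigr do under eq_bigr do rewrite -[t * c * _]mulrA.
move=> h; apply: (le_trans h); rewrite rhoE.
have inv2 : (1 - r0)^-1 <= 1 + L / pi.
  apply: (le_trans (inv_1BexpRN s00)); rewrite lerD2l /s0 invf_div ler_pdivrMr ?exprn_gt0//.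
  rewrite expr2 mulrA divfK ?gt_eqF// mulrC ler_wpM2l ?(ltW L0)//.
  exact: pi_ge2.
have g := gammac_lower l1 k1; rewrite -/L in g.
have Lpi' : 0 <= L / pi by exact: ltW.
have i0 : 0 <= (1 - r)^-1 by rewrite invr_ge0 subr_ge0 ltW.
have h1 : r ^+ l / (1 - r) <= 2 * r0 ^+ l * (2 * (1 + L / pi)).
  apply: ler_pM => //; first by rewrite exprn_ge0// ltW.
  by apply: (le_trans inv1); rewrite ler_wpM2l.
have h2 : (9 + 8 * (L / pi)) * r0 ^+ l <= 16 * gammac l k * r0 ^+ l.
  by rewrite ler_wpM2r ?(ltW e0)//; clear -g Lpi'; move: (L / pi) g Lpi' => ? ? ?; lra.
rewrite -/k; apply: le_trans h2; clear -h1.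
by move: (L / pi) (r0 ^+ l) h1 => x y h1; lra.
Qed.

End KernelApproximation.

(** * The Laplace functional of a measure *)

Section LaplaceFunctional.
Variables (R : realType) (mu : {measure set (measurableTypeR R) -> \bar R}).
Variable f : R -> R.
Hypothesis f_laplace : forall z : R, 0 < z -> (f z)%:E =
  (\int[mu]_(t in `[0%R, +oo[%classic) (expR (- t * z))%:E)%E.
Let H := `[0%R, +oo[%classic : set R.

(** For a combination g of exponentials, G is the same combination of values of f,
    so inequalities between values of f follow from inequalities between
    exponentials.  Integrability is recorded because linearity of the integral
    needs it. *)
Definition laplace_value (g : R -> R) (G : R) :=
  mu.-integrable H (EFin \o g) /\ (\int[mu]_(t in H) (g t)%:E)%E = G%:E.

Let mH : measurable (H : set (measurableTypeR R)).
Proof. exact: measurable_itv. Qed.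

Lemma laplace_value_exp (z : R) : 0 < z ->
  laplace_value (fun t => expR (- (t * z))) (f z).
Proof.
move=> z0; have E : (\int[mu]_(t in H) (expR (- (t * z)))%:E)%E = (f z)%:E.
  by rewrite f_laplace//; apply: eq_integral => t _; rewrite mulNr.
split=> //; apply/integrableP; split.
  apply/measurable_EFinP; apply: measurableT_comp => //.
  by apply: measurable_funTS; apply: continuous_measurable_fun => x;
    apply: cvgN; apply: cvgM; [exact: cvg_id|exact: cvg_cst].
rewrite (eq_integral (fun t : measurableTypeR R => (expR (- ((t : R) * z)))%:E)) => [|t _].
  by rewrite E ltry.
by rewrite /= ger0_norm// expR_ge0.
Qed.

Lemma laplace_valueZ (c : R) g G : laplace_value g G ->
  laplace_value (fun t => c * g t) (c * G).
Proof.
move=> [ig eg]; split; first by have := integrableZl mH c ig.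
under eq_integral do rewrite EFinM.
by rewrite integralZl// eg EFinM.
Qed.

Lemma laplace_valueD g G h K : laplace_value g G -> laplace_value h K ->
  laplace_value (fun t => g t + h t) (G + K).
Proof.
move=> [ig eg] [ih eh]; split; first by have := integrableD mH ig ih.
under eq_integral do rewrite EFinD.
by rewrite integralD// eg eh EFinD.
Qed.

Lemma laplace_valueB g G h K : laplace_value g G -> laplace_value h K ->
  laplace_value (fun t => g t - h t) (G - K).
Proof.
move=> Hg Hh; have := laplace_valueD Hg (laplace_valueZ (-1) Hh).
by rewrite mulN1r; under eq_fun do rewrite mulN1r.
Qed.

Lemma laplace_value_sum (I : Type) (s : seq I) (g : I -> R -> R) (G : I -> R) :
  (forall i, laplace_value (g i) (G i)) ->
  laplace_value (fun t => \sum_(i <- s) g i t) (\sum_(i <- s) G i).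
Proof.
move=> Hg; elim: s => [|i s IH].
  rewrite big_nil; under eq_fun do rewrite big_nil.
  have := laplace_valueZ 0 (laplace_value_exp ltr01).
  by rewrite mul0r; under eq_fun do rewrite mul0r.
rewrite big_cons; under eq_fun do rewrite big_cons.
exact: laplace_valueD.
Qed.

Lemma laplace_value_le g G h K : laplace_value g G -> laplace_value h K ->
  (forall t, 0 <= t -> g t <= h t) -> G <= K.
Proof.
move=> [ig eg] [ih eh] gh; rewrite -lee_fin -eg -eh; apply: le_integral => //.
by move=> t; rewrite inE /H /= in_itv/= andbT => t0; rewrite lee_fin gh.
Qed.

Lemma laplace_nonincreasing (x y : R) : 0 < x -> x <= y -> f y <= f x.
Proof.
move=> x0 xy; apply: (laplace_value_le (laplace_value_exp _) (laplace_value_exp x0)).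
  exact: lt_le_trans xy.
by move=> t t0; rewrite ler_expR lerN2 ler_wpM2l.
Qed.

Lemma laplace_ge0 (x : R) : 0 < x -> 0 <= f x.
Proof.
move=> x0; have h := laplace_value_exp x0.
rewrite -(mul0r (f x)); apply: (laplace_value_le (laplace_valueZ 0 h) h).
by move=> t _; rewrite mul0r expR_ge0.
Qed.

(** The function f is nonincreasing, so the limit at 0+ is the supremum of its
    values near 0, which may be infinite. *)
Lemma laplace_le_limit0p (x : R) : 0 < x -> ((f x)%:E <= limit0p f)%E.
Proof.
move=> x0; have ni : {in Interval (BRight 0) (BLeft x) &, nonincreasing_fun (fun z => (f z)%:E)}.
  move=> u v; rewrite !in_itv/= => /andP[u0 _] _ uv; rewrite lee_fin.
  exact: laplace_nonincreasing.
have b0 : (BRight (0 : R) < BLeft x)%O by rewrite bnd_simp.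
have := @nonincreasing_at_right_cvge R (fun z => (f z)%:E) 0 (BLeft x) b0 ni.
move/cvg_lim => e; rewrite /limit0p e//.
apply: (@le_trans _ _ (f (x / 2))%:E).
  rewrite lee_fin; apply: laplace_nonincreasing; first exact: divr_gt0.
  by rewrite ler_pdivrMr//; lra.
apply: ereal_sup_ubound; exists (x / 2) => //=.
by rewrite in_itv/= divr_gt0//= ltr_pdivrMr//; lra.
Qed.

End LaplaceFunctional.

(** * Norms and singular values *)

Section EuclideanNorm.
Variable R : realType.
Local Open Scope sesquilinear_scope.

Lemma norm2v_ge0 n (x : 'cV[R[i]]_n) : 0 <= norm2v x.
Proof. exact: sqrtr_ge0. Qed.

Lemma norm2v_sqr n (x : 'cV[R[i]]_n) : norm2v x ^+ 2 = \sum_i normc (x i 0) ^+ 2.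
Proof. by rewrite sqr_sqrtr// sumr_ge0// => i _; exact: sqr_ge0. Qed.

Lemma norm2v_dot n (x : 'cV[R[i]]_n) : (x^t* *m x) 0 0 = (norm2v x ^+ 2)%:C.
Proof.
rewrite norm2v_sqr mxE rmorph_sum; apply: eq_bigr => i _.
by rewrite !mxE -normCKC rmorphXn.
Qed.

Lemma norm2v_inj n m (x : 'cV[R[i]]_n) (y : 'cV[R[i]]_m) :
  (x^t* *m x) 0 0 = (y^t* *m y) 0 0 -> norm2v x = norm2v y.
Proof.
rewrite !norm2v_dot => /complexI e.
by apply/eqP; rewrite -(@eqrXn2 _ 2)// ?norm2v_ge0// e.
Qed.

Lemma unitarymxK n (W : 'M[R[i]]_n) : W \is unitarymx -> W^t* *m W = 1%:M.
Proof. by move=> uW; rewrite -invmx_unitary// mulVmx// unitarymx_unit. Qed.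

Lemma norm2v_unitary n (W : 'M[R[i]]_n) (x : 'cV[R[i]]_n) :
  W \is unitarymx -> norm2v (W *m x) = norm2v x.
Proof.
move=> uW; apply: norm2v_inj.
by rewrite trmx_mul map_mxM -mulmxA (mulmxA _ W) unitarymxK// mul1mx.
Qed.

Lemma norm2v_eq0 n (x : 'cV[R[i]]_n) : norm2v x = 0 -> x = 0.
Proof.
move=> x0; have := norm2v_sqr x; rewrite x0 expr0n /= => /esym/eqP.
rewrite psumr_eq0 => [/allP h|i _]; last exact: sqr_ge0.
apply/matrixP => i j; rewrite ord1 mxE.
by have := h i (mem_index_enum i); rewrite sqrf_eq0 => /eqP/eq0_normc.
Qed.

Lemma norm2v0 n : norm2v (0 : 'cV[R[i]]_n) = 0.
Proof.
by rewrite /norm2v big1 ?sqrtr0// => i _; rewrite mxE normc0 expr0n.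
Qed.

Lemma norm2vZ n (c : R[i]) (x : 'cV[R[i]]_n) : norm2v (c *: x) = normc c * norm2v x.
Proof.
apply/eqP; rewrite -(@eqrXn2 _ 2)// ?norm2v_ge0 ?mulr_ge0 ?normc_ge0 ?norm2v_ge0//.
rewrite exprMn !norm2v_sqr mulr_sumr; apply/eqP; apply: eq_bigr => i _.
by rewrite mxE normcM exprMn.
Qed.

(** Termwise arithmetic-geometric mean with the weight s = ||y|| / ||x||. *)
Lemma cauchy_schwarz n (x y : 'cV[R[i]]_n) :
  complex.Re ((x^t* *m y) 0 0) <= norm2v x * norm2v y.
Proof.
have [x0|x0] := eqVneq (norm2v x) 0.
  by rewrite x0 mul0r (norm2v_eq0 x0) trmx0 map_mx0 mul0mx mxE.
have [y0|y0] := eqVneq (norm2v y) 0.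
  by rewrite y0 mulr0 (norm2v_eq0 y0) mulmx0 mxE.
have nx : 0 < norm2v x by rewrite lt_neqAle eq_sym x0 norm2v_ge0.
have ny : 0 < norm2v y by rewrite lt_neqAle eq_sym y0 norm2v_ge0.
pose s := norm2v y / norm2v x; have s0 : 0 < s by rewrite divr_gt0.
have ReSum (F : 'I_n -> R[i]) : complex.Re (\sum_i F i) = \sum_i complex.Re (F i).
  by apply: big_morph => // [[? ?] [? ?]].
rewrite mxE ReSum.
apply: (@le_trans _ _ (\sum_i (s * normc (x i 0) ^+ 2 + s^-1 * normc (y i 0) ^+ 2) / 2)).
  apply: ler_sum => i _; rewrite !mxE.
  apply: (@le_trans _ _ (normc (x i 0) * normc (y i 0))).
    apply: (le_trans (ler_norm _)); apply: (le_trans (normc_Re _)).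
    rewrite normcM ler_wpM2r ?normc_ge0//.
    have : `|(x i 0)^* | = `|x i 0| by rewrite norm_conjC.
    by move=> /complexI ->.
  move: (normc (x i 0)) (normc (y i 0)) => u v.
  rewrite ler_pdivlMr//.
  have -> : s * u ^+ 2 + s^-1 * v ^+ 2 = s^-1 * (s * u - v) ^+ 2 + u * v * 2.
    by field; rewrite gt_eqF.
  by rewrite lerDr mulr_ge0 ?sqr_ge0// invr_ge0 ltW.
rewrite -mulr_suml big_split/= -!mulr_sumr -!norm2v_sqr.
rewrite le_eqVlt; apply/orP; left; apply/eqP; rewrite /s; field.
by rewrite !gt_eqF.
Qed.

Lemma norm2v_diag n (e : 'I_n -> R) (x : 'cV[R[i]]_n) (T : R) : 0 <= T ->
  (forall i, `|e i| <= T) ->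
  norm2v (\col_i ((e i)%:C * x i 0)) <= T * norm2v x.
Proof.
move=> T0 eT; rewrite -(@ler_pXn2r _ 2)// ?nnegrE ?norm2v_ge0// ?mulr_ge0 ?norm2v_ge0//.
rewrite exprMn !norm2v_sqr mulr_sumr; apply: ler_sum => i _.
rewrite mxE normcM normc_real exprMn ler_wpM2r ?sqr_ge0//.
by rewrite lerXn2r ?nnegrE.
Qed.

Lemma norm2_ub m n (F : 'M[R[i]]_(m, n)) : has_ubound
  [set norm2v (F *m x) | x in [set x : 'cV[R[i]]_n | norm2v x <= 1]]%classic.
Proof.
exists (Num.sqrt (\sum_i (\sum_j normc (F i j)) ^+ 2)) => _ [x /= x1 <-].
rewrite ler_sqrt ?sumr_ge0// => [|i _]; last exact: sqr_ge0.
apply: ler_sum => i _.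
rewrite lerXn2r ?nnegrE ?normc_ge0 ?sumr_ge0// => [j _|]; first exact: normc_ge0.
rewrite mxE; apply: (le_trans (le_normc_sum _ _ _)); apply: ler_sum => j _.
rewrite normcM ler_piMr ?normc_ge0//.
apply: le_trans x1; rewrite -(@ler_pXn2r _ 2)// ?nnegrE ?norm2v_ge0 ?normc_ge0//.
rewrite norm2v_sqr (bigD1 j)//= lerDl sumr_ge0// => k _; exact: sqr_ge0.
Qed.

Lemma norm2_ge0 m n (F : 'M[R[i]]_(m, n)) : 0 <= norm2 F.
Proof.
apply: ub_le_sup; first exact: norm2_ub.
by exists 0; rewrite /= ?mulmx0 norm2v0.
Qed.

Lemma norm2v_mulmx m n (F : 'M[R[i]]_(m, n)) (x : 'cV[R[i]]_n) :
  norm2v (F *m x) <= norm2 F * norm2v x.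
Proof.
have [x0|x0] := eqVneq (norm2v x) 0.
  by rewrite x0 (norm2v_eq0 x0) mulmx0 norm2v0 mulr0.
have nx : 0 < norm2v x by rewrite lt_neqAle eq_sym x0 norm2v_ge0.
rewrite -ler_pdivrMr//.
have ncx : normc ((norm2v x)^-1)%:C = (norm2v x)^-1.
  by rewrite normc_real ger0_norm// invr_ge0 ltW.
have -> : norm2v (F *m x) / norm2v x = norm2v (F *m (((norm2v x)^-1)%:C *: x)).
  by rewrite -scalemxAr norm2vZ ncx mulrC.
apply: ub_le_sup; first exact: norm2_ub.
by exists (((norm2v x)^-1)%:C *: x) => //=; rewrite norm2vZ ncx mulVf.
Qed.

Lemma spectral_decomposition n (A : 'M[R[i]]_n) : A \is hermsymmx ->
  let P := spectralmx A in
  [/\ P \is unitarymx, A = P^t* *m diag_mx (spectral_diag A) *m P &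
    forall i, spectral_diag A 0 i = (complex.Re (spectral_diag A 0 i))%:C].
Proof.
move=> hA P; have uP : P \is unitarymx by exact: spectral_unitarymx.
split=> // [|i].
  rewrite -invmx_unitary//.
  exact: (orthomx_spectralP (hermitian_normalmx hA)).
have /mxOverP/(_ 0 i) := hermitian_spectral_diag_real hA.
by move/RRe_real.
Qed.

Lemma gram_hermitian m n (X : 'M[R[i]]_(m, n)) : X^t* *m X \is hermsymmx.
Proof.
apply/is_hermitianmxP; rewrite expr0 scale1r trmx_mul map_mxM.
by rewrite map_trmx trmxK -map_mx_comp (map_mx_id (@conjCK _)).
Qed.

(** The first r + 1 entries of the sorted list all exceed t.  For t >= 0 the default
    value 0 cannot exceed t, which excludes an index beyond the end. *)
Lemma nth_sort_ge_count (s : seq R) (r : nat) (t : R) : 0 <= t ->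
  t < nth 0 (sort >=%R s) r -> (r < count (fun x => t < x)%R s)%N.
Proof.
move=> t0 tr; have rs : (r < size (sort >=%R s))%N.
  by rewrite ltnNge; apply/negP => h; move: tr; rewrite nth_default// ltNge t0.
rewrite -(permP (_ : perm_eq (sort >=%R s) s)) ?perm_sort//.
rewrite -[sort _ _](cat_take_drop r.+1) count_cat.
suff -> : count (fun x => t < x)%R (take r.+1 (sort >=%R s)) = r.+1.
  by rewrite ltn_addr.
have st : size (take r.+1 (sort >=%R s)) = r.+1 by rewrite size_takel.
rewrite -[RHS]st; apply/eqP; rewrite -all_count; apply/(all_nthP 0) => i.
rewrite st ltnS => ir; rewrite nth_take ?ltnS//; apply: (lt_le_trans tr).
have so : sorted >=%R (sort >=%R s).
  by apply: sort_sorted => x y; exact: le_total.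
apply: (sorted_leq_nth _ _ 0 so) => //; rewrite ?inE//.
- by move=> x y z /= h1 h2; exact: le_trans h2 h1.
- by move=> x /=.
- exact: leq_ltn_trans rs.
Qed.

(** The easy half of the Eckart-Young theorem.  If more than r singular values of X
    exceeded t, the span of their right singular vectors would meet the kernel of Y
    in some v != 0, and there X v = (X - Y) v would be longer than t ||v||. *)
Lemma sigma_le_of_low_rank n (X Y : 'M[R[i]]_n) (r : nat) (t : R) :
  0 <= t -> (\rank Y <= r)%N ->
  (forall v, norm2v ((X - Y) *m v) <= t * norm2v v) ->
  sigma (1 + r) X <= t.
Proof.
move=> t0 rY XY; rewrite leNgt; apply/negP => ts.
have [uW GE lamE] := spectral_decomposition (gram_hermitian X).
set W := spectralmx _ in uW GE; set lam := spectral_diag _ in GE lamE.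
pose I := [set i : 'I_n | t < Num.sqrt (complex.Re (lam 0 i))].
have rI : (r < #|I|)%N.
  have := nth_sort_ge_count t0 ts; rewrite count_map => h.
  by rewrite cardsE cardE /enum_mem size_filter -enumT.
(* The columns of S are the coordinate vectors of I; w = S u^T is a vector
   supported in I such that v = W^* w lies in the kernel of Y. *)
pose S : 'M[R[i]]_(n, #|I|) := \matrix_(i, j) (i == enum_val j)%:R.
pose Z := Y *m W^t* *m S.
have rZ : (\rank Z^T < #|I|)%N.
  rewrite mxrank_tr; apply: leq_ltn_trans rI; apply: leq_trans rY.
  by rewrite (leq_trans (mxrankM_maxl _ _))// mxrankM_maxl.
have [u u0 uZ] : exists2 u : 'rV[R[i]]_#|I|, u != 0 & u *m Z^T = 0.
  have : kermx Z^T != 0 by rewrite -mxrank_eq0 mxrank_ker -lt0n subn_gt0.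
  by move=> /rowV0Pn[u /sub_kermxP uZ u0]; exists u.
pose w := S *m u^T; pose v := W^t* *m w.
have Yv : Y *m v = 0.
  by rewrite /v /w !mulmxA -/Z -[Z]trmxK -trmx_mul uZ trmx0.
have uWt : W^t* \is unitarymx by rewrite trmxC_unitary.
have nv : norm2v v = norm2v w by exact: norm2v_unitary.
have wI (j : 'I_#|I|) : w (enum_val j) 0 = u 0 j.
  rewrite mxE (bigD1 j)//= !mxE eqxx mul1r big1 ?addr0// => k kj.
  by rewrite mxE (inj_eq enum_val_inj) eq_sym (negPf kj) mul0r.
have wnI i : i \notin I -> w i 0 = 0.
  move=> iI; rewrite mxE big1// => k _; rewrite mxE.
  case: eqP => [e|_]; last by rewrite mul0r.
  by move: iI; rewrite e enum_valP.
have w0 : exists2 i, i \in I & w i 0 != 0.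
  have /rV0Pn[j uj] := u0.
  by exists (enum_val j); [exact: enum_valP|rewrite wI].
have NX : norm2v (X *m v) ^+ 2 = \sum_i complex.Re (lam 0 i) * normc (w i 0) ^+ 2.
  apply: (@complexI R); rewrite -norm2v_dot.
  rewrite trmx_mul map_mxM -mulmxA (mulmxA _ X) GE.
  rewrite /v trmx_mul map_mxM map_trmx trmxK -map_mx_comp (map_mx_id (@conjCK _)).
  rewrite !mulmxA -[_ *m W *m _]mulmxA (unitarymxP uW) mulmx1.
  rewrite -[_ *m W *m W^t*]mulmxA (unitarymxP uW) mulmx1 -mulmxA.
  rewrite mxE rmorph_sum; apply: eq_bigr => i _.
  rewrite mul_mx_diag -/w; move: (w) => y; rewrite !mxE lamE mulrAC -normCKC.
  by rewrite mulrC rmorphM rmorphXn.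
have : norm2v (X *m v) ^+ 2 <= (t * norm2v v) ^+ 2.
  rewrite lerXn2r ?nnegrE ?norm2v_ge0 ?mulr_ge0 ?norm2v_ge0//.
  by have := XY v; rewrite mulmxBl Yv subr0.
apply/negP; rewrite -ltNge NX exprMn nv norm2v_sqr mulr_sumr.
have lam_gt i : i \in I -> t ^+ 2 < complex.Re (lam 0 i).
  rewrite inE => h; have l0 : 0 <= complex.Re (lam 0 i).
    by rewrite leNgt; apply/negP => ln; move: h; rewrite ler0_sqrtr ?(ltW ln)// ltNge t0.
  by rewrite -[ltRHS]sqr_sqrtr// ltrXn2r ?nnegrE ?sqrtr_ge0.
have le_term i : t ^+ 2 * normc (w i 0) ^+ 2 <=
    complex.Re (lam 0 i) * normc (w i 0) ^+ 2.
  have [iI|iI] := boolP (i \in I); last by rewrite wnI// normc0 expr0n !mulr0.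
  by rewrite ler_wpM2r ?sqr_ge0// ltW// lam_gt.
have [i0 i0I wi0] := w0.
rewrite (bigD1 i0)//= [ltRHS](bigD1 i0)//=; apply: ltr_leD; last exact: ler_sum.
rewrite ltr_pM2r ?lam_gt// exprn_gt0// lt_neqAle normc_ge0 andbT eq_sym.
by apply: contra wi0 => /eqP/eq0_normc ->.
Qed.

End EuclideanNorm.

(** * Functions of the Sylvester operator *)

Section SylvesterFunction.
Variable R : realType.
Local Open Scope sesquilinear_scope.
Local Notation C := R[i].

Lemma vecE m n (X : 'M[C]_(m, n)) i j : vec X (mxtens_index (j, i)) 0 = X i j.
Proof. by rewrite mxE mxtens_indexK. Qed.

Lemma vec_inj m n : injective (@vec C m n).
Proof.
by move=> X Y e; apply/matrixP => i j; rewrite -(vecE X i j) e vecE.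
Qed.

Lemma vecB m n (X Y : 'M[C]_(m, n)) : vec (X - Y) = vec X - vec Y.
Proof. by apply/matrixP => i j; rewrite !mxE. Qed.

Lemma vecZ m n (c : C) (X : 'M[C]_(m, n)) : vec (c *: X) = c *: vec X.
Proof. by apply/matrixP => i j; rewrite !mxE. Qed.

Lemma vec_sum m n (I : finType) (F : I -> 'M[C]_(m, n)) :
  vec (\sum_i F i) = \sum_i vec (F i).
Proof.
apply/matrixP => i j; rewrite mxE !summxE; apply: eq_bigr => k _.
by rewrite !mxE.
Qed.

Lemma tensmx_vec n (P Q X : 'M[C]_n) : (P *t Q) *m vec X = vec (Q *m X *m P^T).
Proof.
apply/matrixP => p z; rewrite ord1 {z}; case: (mxtens_indexP p) => j i.
rewrite vecE mxE (reindex (@mxtens_index n n)) /=; last first.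
  exists (@mxtens_unindex n n) => x _; [exact: mxtens_indexK|exact: mxtens_unindexK].
rewrite mxE (eq_bigr (fun x : 'I_n * 'I_n => P j x.1 * Q i x.2 * X x.2 x.1)); last first.
  by move=> [k h] _; rewrite tensmxE vecE.
rewrite -(pair_bigA _ (fun k h => P j k * Q i h * X h k)) /=; apply: eq_bigr => k _.
rewrite !mxE mulr_suml; apply: eq_bigr => h _; ring.
Qed.

(** The coordinates of v in the diagonalizing basis vanish except where the diagonal
    entry is z.  Thus f of a matrix can be evaluated on any eigenvector, whichever
    diagonalization defines it. *)
Lemma conj_diag_eigenvector (K : fieldType) n (P : 'M[K]_n) (d e : 'rV[K]_n)
    (v : 'cV[K]_n) (z y : K) : P \in unitmx ->
  (forall i, d 0 i = z -> e 0 i = y) ->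
  invmx P *m diag_mx d *m P *m v = z *: v ->
  invmx P *m diag_mx e *m P *m v = y *: v.
Proof.
move=> uP de Pv.
have [u uE] : exists u, u = P *m v by exists (P *m v).
have vE : v = invmx P *m u by rewrite uE mulKmx.
have du : diag_mx d *m u = z *: u.
  apply: (can_inj (mulKmx (_ : invmx P \in unitmx))); first by rewrite unitmx_inv.
  by rewrite -scalemxAr -vE uE !mulmxA.
have eu : diag_mx e *m u = y *: u.
  apply/matrixP => i j; have := congr1 (fun N : 'cV[K]_n => N i j) du.
  rewrite !mul_diag_mx !mxE => h.
  have [->|u0] := eqVneq (u i j) 0; first by rewrite !mulr0.
  by rewrite (de i (mulIf u0 h)).
by rewrite -!mulmxA -uE eu -scalemxAr -vE.
Qed.

Lemma mxfun_eigenvector n (f : R -> R) (M : 'M[C]_n) (v : 'cV[C]_n) (z : R) :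
  M \is hermsymmx -> M *m v = z%:C *: v -> mxfun f M *m v = (f z)%:C *: v.
Proof.
move=> hM; rewrite {1}(orthomx_spectralP (hermitian_normalmx hM)).
by apply: conj_diag_eigenvector (spectral_unit M) _ => i di; rewrite mxE di.
Qed.

Lemma hermsymmxE n (A : 'M[C]_n) : A \is hermsymmx -> A^t* = A.
Proof. by move/is_hermitianmxP; rewrite expr0 scale1r => {2}->. Qed.

Lemma sylvester_hermitian n (A B : 'M[C]_n) :
  A \is hermsymmx -> - B \is hermsymmx ->
  tensmx (1%:M : 'M[C]_n) A - tensmx B^T (1%:M : 'M[C]_n) \is hermsymmx.
Proof.
move=> hA hB; apply/is_hermitianmxP; rewrite expr0 scale1r.
have BE : B^t* = B.
  by have := hermsymmxE hB; rewrite linearN /= map_mxN => /oppr_inj.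
rewrite linearB /= map_mxB !trmx_tens !map_mxT (hermsymmxE hA).
rewrite trmx1 map_mx1 trmxK; congr (_ - _ *t _).
by rewrite -[in LHS]BE map_trmx trmxK.
Qed.

(** The products of an eigenvector of A and a left eigenvector of -B are eigenvectors
    of the Sylvester operator for al_i + be_j, and they form a basis of the matrices. *)
Lemma mxfun_sylvester n (f : R -> R) (A B X F P Q : 'M[C]_n) (al be : 'I_n -> R) :
  A \is hermsymmx -> - B \is hermsymmx -> P \is unitarymx -> Q \is unitarymx ->
  A = P^t* *m diag_mx (\row_i (al i)%:C) *m P ->
  - B = Q^t* *m diag_mx (\row_i (be i)%:C) *m Q ->
  vec X = mxfun f (tensmx (1%:M : 'M[C]_n) A - tensmx B^T (1%:M : 'M[C]_n)) *m vec F ->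
  X = P^t* *m (\matrix_(i, j) ((f (al i + be j))%:C * (P *m F *m Q^t*) i j)) *m Q.
Proof.
move=> hA hB uP uQ AE BE XE.
have PP := unitarymxP uP; have QQ := unitarymxP uQ.
pose E i j := P^t* *m delta_mx i j *m Q.
have expand (D : 'M[C]_n) : P^t* *m D *m Q = \sum_i \sum_j D i j *: E i j.
  rewrite {1}[D]matrix_sum_delta mulmx_sumr mulmx_suml; apply: eq_bigr => i _.
  rewrite mulmx_sumr mulmx_suml; apply: eq_bigr => j _.
  by rewrite /E -scalemxAr -scalemxAl.
have eigE i j : (tensmx (1%:M : 'M[C]_n) A - tensmx B^T (1%:M : 'M[C]_n)) *m vec (E i j) =
    (al i + be j)%:C *: vec (E i j).
  rewrite mulmxBl !tensmx_vec trmx1 mulmx1 mul1mx trmxK -vecB -vecZ; congr vec.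
  have -> : A *m E i j = (al i)%:C *: E i j.
    rewrite AE /E !mulmxA -[_ *m P *m _]mulmxA PP mulmx1.
    rewrite -[_ *m diag_mx _ *m _]mulmxA.
    rewrite (_ : diag_mx _ *m delta_mx i j = (al i)%:C *: delta_mx i j).
      by rewrite -scalemxAr -scalemxAl.
    rewrite mul_diag_mx; apply/matrixP => a c; rewrite !mxE.
    by case: (eqVneq a i) => [-> //|_]; rewrite !mulr0.
  rewrite -mulmxN BE /E !mulmxA -[_ *m Q *m _]mulmxA QQ mulmx1.
  rewrite -[_ *m delta_mx i j *m diag_mx _]mulmxA.
  rewrite (_ : delta_mx i j *m diag_mx _ = (be j)%:C *: delta_mx i j).
    by rewrite -scalemxAr -!scalemxAl -scalerDl -rmorphD.
  rewrite mul_mx_diag; apply/matrixP => a c; rewrite !mxE.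
  case: (eqVneq c j) => [->|_]; first by rewrite mulrC.
  by rewrite andbF mulr0 mul0r.
have FE : F = P^t* *m (P *m F *m Q^t*) *m Q.
  rewrite !mulmxA (unitarymxK uP) mul1mx -[_ *m Q^t* *m _]mulmxA (unitarymxK uQ).
  by rewrite mulmx1.
apply: vec_inj; rewrite XE {1}FE !expand !vec_sum mulmx_sumr.
apply: eq_bigr => i _; rewrite !vec_sum mulmx_sumr; apply: eq_bigr => j _.
rewrite !vecZ -scalemxAr (mxfun_eigenvector _ (sylvester_hermitian hA hB) (eigE i j)).
by rewrite scalerA [in RHS]mxE mulrC.
Qed.

Lemma eigenvalue_unitary_diag n (P : 'M[C]_n) (d : 'rV[C]_n) i :
  P \is unitarymx -> eigenvalue (P^t* *m diag_mx d *m P) (d 0 i).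
Proof.
move=> /unitarymxP PP; apply/eigenvalueP; exists (row i P).
  rewrite -row_mul !mulmxA PP mul1mx mul_diag_mx.
  by apply/rowP => j; rewrite !mxE.
apply/eqP => r0; have : row i (P *m P^t*) = row i 1%:M by rewrite PP.
rewrite row_mul r0 mul0mx => /rowP/(_ i); rewrite !mxE eqxx => /esym/eqP.
by rewrite oner_eq0.
Qed.

Lemma spectrum_in_diag n (A : 'M[C]_n) (a b : R) : A \is hermsymmx -> spectrum_in A a b ->
  exists (P : 'M[C]_n) (al : 'I_n -> R), [/\ P \is unitarymx,
    A = P^t* *m diag_mx (\row_i (al i)%:C) *m P & forall i, a <= al i <= b].
Proof.
move=> /spectral_decomposition[]; move: (spectralmx A) (spectral_diag A) => P d uP AE dR sA.
have dE : d = \row_i (complex.Re (d 0 i))%:C by apply/rowP => i; rewrite mxE -dR.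
exists P, (fun i => complex.Re (d 0 i)); split; [exact: uP|by rewrite -dE|] => i.
have := eigenvalue_unitary_diag d i uP; rewrite -AE => /sA.
by rewrite dR !lecR.
Qed.

End SylvesterFunction.

(** * The singular value bound *)

Section MainBound.
Variable R : realType.
Local Open Scope sesquilinear_scope.
Local Notation C := R[i].

Lemma mxrank_sum_le (F : fieldType) m n (I : Type) (s : seq I) (M : I -> 'M[F]_(m, n))
    (k : nat) : (forall i, (\rank (M i) <= k)%N) ->
  (\rank (\sum_(i <- s) M i)%R <= size s * k)%N.
Proof.
move=> Mk; elim: s => [|i s IH]; first by rewrite big_nil mxrank0.
rewrite big_cons /= mulSn; apply: (leq_trans (mxrank_add _ _)).
exact: leq_add.
Qed.

(** Each term of the separated multiplier acts as a product of diagonal matrices on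
    both sides of F. *)
Lemma low_rank_multiplier n l k (F : 'M[C]_n) (p q : nat -> 'I_n -> R) :
  (\rank F <= k)%N ->
  (\rank (\matrix_(i, j) ((\sum_(m < l) p m i * q m j)%:C * F i j))%R <= l * k)%N.
Proof.
move=> rF.
have -> : \matrix_(i, j) ((\sum_(m < l) p m i * q m j)%:C * F i j) =
    \sum_(m < l) diag_mx (\row_i (p m i)%:C) *m F *m diag_mx (\row_j (q m j)%:C).
  apply/matrixP => i j; rewrite mxE summxE rmorph_sum mulr_suml; apply: eq_bigr => m _.
  by rewrite mul_mx_diag mxE mul_diag_mx !mxE rmorphM /=; ring.
have := @mxrank_sum_le _ n n _ (index_enum 'I_l)
  (fun m : 'I_l => diag_mx (\row_i (p m i)%:C) *m F *m diag_mx (\row_j (q m j)%:C)) k.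
rewrite [size _](_ : _ = l); last by rewrite [index_enum _]unlock -enumT size_enum_ord.
apply=> m.
apply: leq_trans rF; apply: (leq_trans (mxrankM_maxl _ _)); exact: mxrankM_maxr.
Qed.

Lemma multiplierB n (F : 'M[C]_n) (g h : 'I_n -> 'I_n -> R) :
  (\matrix_(i, j) ((g i j)%:C * F i j)) - (\matrix_(i, j) ((h i j)%:C * F i j)) =
  \matrix_(i, j) ((g i j - h i j)%:C * F i j).
Proof. by apply/matrixP => i j; rewrite !mxE rmorphB mulrBl. Qed.

(** With w the image of v, ||w||^2 is a combination of values of f.  For each t the
    same combination of exponentials is a sesquilinear form of F, in which the left
    vector is multiplied by the error of the kernel approximation and the right one
    by e^{-t be_j} <= e^{-ta}; it is at most T ||F|| ||v|| ||w|| e^{-ta}.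
    Integration against mu turns e^{-ta} into f(a). *)
Lemma multiplier_error_bound n (mu : {measure set (measurableTypeR R) -> \bar R})
    (f : R -> R) (a T : R) (F P Q : 'M[C]_n) (al be : 'I_n -> R)
    (N l : nat) (sg : nat -> R) (p : nat -> R -> R) (q : nat -> nat -> R) :
  (forall z : R, 0 < z -> (f z)%:E =
     (\int[mu]_(t in `[0%R, +oo[%classic) (expR (- t * z))%:E)%E) ->
  0 < a -> 0 <= T -> P \is unitarymx -> Q \is unitarymx ->
  (forall i, 0 < al i) -> (forall j, a <= be j) -> (forall j, 0 < sg j) ->
  (forall i t, 0 <= t -> `|expR (- (t * al i)) - \sum_(n < l) p n (al i) *
       \sum_(j < N) q n j * expR (- (t * sg j))| <= T) ->
  let E := \matrix_(i, j) ((f (al i + be j) - \sum_(n < l) p n (al i) *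
      \sum_(m < N) q n m * f (sg m + be j))%:C * (P *m F *m Q^t*) i j) in
  forall v, norm2v (P^t* *m E *m Q *m v) <= T * f a * norm2 F * norm2v v.
Proof.
move=> hf a0 T0 uP uQ al0 be_a sg0 HT E v.
set w := P^t* *m E *m Q *m v; pose x := P *m w; pose y := Q *m v.
pose Ft := P *m F *m Q^t*.
pose r i j := complex.Re ((x i 0)^* * Ft i j * y j 0).
pose G i j := f (al i + be j) - \sum_(n < l) p n (al i) * \sum_(m < N) q n m * f (sg m + be j).
pose g i j t := expR (- (t * (al i + be j))) - \sum_(n < l) p n (al i) *
   \sum_(m < N) q n m * expR (- (t * (sg m + be j))).
have uQt : Q^t* \is unitarymx by rewrite trmxC_unitary.
have be0 j : 0 < be j by exact: lt_le_trans (be_a j).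
have nx : norm2v x = norm2v w by exact: norm2v_unitary.
have ny : norm2v y = norm2v v by exact: norm2v_unitary.
have ReSum (I : finType) (h : I -> C) : complex.Re (\sum_i h i) = \sum_i complex.Re (h i).
  by apply: big_morph => // [[? ?] [? ?]].
have ReR (c : R) (z : C) : complex.Re (c%:C * z) = c * complex.Re z.
  by case: z => u u' /=; rewrite mul0r subr0.
have bilin (D : 'I_n -> 'I_n -> R) (u u' : 'cV[C]_n) :
    complex.Re ((u^t* *m (\matrix_(i, j) ((D i j)%:C * Ft i j)) *m u') 0 0) =
    \sum_i \sum_j D i j * complex.Re ((u i 0)^* * Ft i j * u' j 0).
  rewrite exchange_big -mulmxA mxE ReSum.
  rewrite exchange_big; apply: eq_bigr => i _ /=.
  rewrite !mxE mulr_sumr ReSum; apply: eq_bigr => j _.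
  by rewrite mxE -ReR; congr complex.Re; ring.
have sq : norm2v w ^+ 2 = \sum_i \sum_j G i j * r i j.
  rewrite -[LHS]/(complex.Re (norm2v w ^+ 2)%:C) -norm2v_dot -bilin.
  congr (complex.Re (_ 0 0)); have -> : x^t* = w^t* *m P^t*.
    by rewrite /x; move: (w) => w'; rewrite trmx_mul map_mxM.
  by rewrite -!mulmxA; congr (_ *m _); rewrite /w /y !mulmxA.
pose K := T * norm2v w * norm2 F * norm2v v.
have laplace_g : laplace_value mu (fun t => \sum_i \sum_j r i j * g i j t)
    (\sum_i \sum_j r i j * G i j).
  apply: (laplace_value_sum hf) => i; apply: (laplace_value_sum hf) => j; apply: laplace_valueZ.
  apply: laplace_valueB; first by apply: laplace_value_exp => //; exact: addr_gt0.
  apply: (laplace_value_sum hf) => m; apply: laplace_valueZ; apply: (laplace_value_sum hf) => h.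
  by apply: laplace_valueZ; apply: laplace_value_exp => //; exact: addr_gt0.
have bound t : 0 <= t -> \sum_i \sum_j r i j * g i j t <= K * expR (- (t * a)).
  move=> t0; pose e i := expR (- (t * al i)) - \sum_(n < l) p n (al i) *
       \sum_(j < N) q n j * expR (- (t * sg j)).
  pose d j := expR (- (t * be j)).
  have gE i j : g i j t = e i * d j.
    rewrite /g /e /d mulrBl mulr_suml -expRD; congr (expR _ - _); first by ring.
    apply: eq_bigr => m _; rewrite -mulrA mulr_suml; congr (_ * _); apply: eq_bigr => h _.
    by rewrite -mulrA -expRD; congr (_ * expR _); ring.
  pose xe : 'cV[C]_n := \col_i ((e i)%:C * x i 0).
  pose yd : 'cV[C]_n := \col_j ((d j)%:C * y j 0).
  have -> : \sum_i \sum_j r i j * g i j t = complex.Re ((xe^t* *m (Ft *m yd)) 0 0).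
    have FtE : Ft = \matrix_(i, j) (1%:C * Ft i j).
      by apply/matrixP => i j; rewrite mxE rmorph1 mul1r.
    rewrite [_ *m (Ft *m yd)]mulmxA [in RHS]FtE (bilin (fun _ _ => 1)).
    apply: eq_bigr => i _; apply: eq_bigr => j _.
    rewrite mul1r gE /r mulrC -ReR; congr complex.Re.
    rewrite [xe i 0]mxE [yd j 0]mxE [RHS](_ : _ = ((e i)%:C^* * (d j)%:C) *
      ((x i 0)^* * Ft i j * y j 0)); last by rewrite rmorphM; ring.
    have er : (e i)%:C \is Num.real.
      by rewrite -[(e i)%:C]/(e i +i* 0) complex_real.
    by rewrite (conj_Creal er) -rmorphM.
  apply: (le_trans (cauchy_schwarz _ _)).
  have h1 : norm2v xe <= T * norm2v w.
    by rewrite -nx; apply: norm2v_diag => // i; exact: HT.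
  have h2 : norm2v yd <= expR (- (t * a)) * norm2v v.
    rewrite -ny; apply: norm2v_diag => [|j]; first exact: expR_ge0.
    by rewrite ger0_norm ?expR_ge0// ler_expR lerN2 ler_wpM2l.
  have h3 : norm2v (Ft *m yd) <= norm2 F * norm2v yd.
    rewrite /Ft -!mulmxA norm2v_unitary//; apply: (le_trans (norm2v_mulmx _ _)).
    by rewrite (norm2v_unitary _ uQt).
  have h4 := le_trans h3 (ler_wpM2l (norm2_ge0 F) h2).
  apply: (le_trans (ler_pM (norm2v_ge0 _) (norm2v_ge0 _) h1 h4)).
  by rewrite le_eqVlt; apply/orP; left; apply/eqP; rewrite /K; ring.
have sqK : norm2v w ^+ 2 <= K * f a.
  rewrite sq.
  have -> : \sum_i \sum_j G i j * r i j = \sum_i \sum_j r i j * G i j.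
    by apply: eq_bigr => i _; apply: eq_bigr => j _; rewrite mulrC.
  apply: (laplace_value_le laplace_g (laplace_valueZ K (laplace_value_exp hf a0))).
  exact: bound.
have fa := laplace_ge0 hf a0.
have rhs0 : 0 <= T * f a * norm2 F * norm2v v.
  by rewrite !mulr_ge0 ?norm2_ge0 ?norm2v_ge0.
have [w0|w0] := eqVneq (norm2v w) 0; first by rewrite w0.
have wp : 0 < norm2v w by rewrite lt_neqAle eq_sym w0 norm2v_ge0.
rewrite -(ler_pM2l wp) -expr2; apply: (le_trans sqK).
by rewrite le_eqVlt; apply/orP; left; apply/eqP; rewrite /K; ring.
Qed.

End MainBound.

(* The bound is in \bar R since f(0^+) may be +oo.  The convention 0 * +oo = 0
   only intervenes when F = 0, and then X = 0. *)
Theorem theorem4p10 (R : realType) (n k : nat) (a b : R) (f : R -> R)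
  (A B X F : 'M[R[i]]_n) (U V : 'M[R[i]]_(n, k))
  (ha : 0 < a) (hab : a < b)
  (hf : laplace_stieltjes f)
  (hA : posdefmx A) (hAab : spectrum_in A a b)
  (hB : posdefmx (- B)) (hBab : spectrum_in (- B) a b)
  (hF : F = U *m V^T) (hrank : \rank F = k)
  (hX : vec X =
        mxfun f (tensmx (1%:M : 'M[R[i]]_n) A - tensmx B^T (1%:M : 'M[R[i]]_n))
          *m vec F)
  (l : nat) (hl : (1 <= l)%N) :
  ((sigma (1 + l * k) X)%:E <=
     (16 * gammac l (b / a))%:E * limit0p f
       * (rho a b `^ (l%:R / 2) * norm2 F)%:E)%E.
Proof.
have [mu Hmu] := hf.
have [P [al [uP AE al_ab]]] := spectrum_in_diag hA.1 hAab.
have [Q [be [uQ BE be_ab]]] := spectrum_in_diag hB.1 hBab.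
have XE := mxfun_sylvester hA.1 hB.1 uP uQ AE BE hX.
have [N [sg [p [q [sg0 approx]]]]] := laplace_kernel_approx ha hab hl.
set g := 16 * gammac l (b / a) in approx *; set rh := rho a b `^ _ in approx *.
have T0 : 0 <= g * rh.
  by apply: le_trans (normr_ge0 _) (approx a 0 _ _); rewrite ?lexx// ltW.
have rh0 : 0 <= rh by exact: powR_ge0.
pose Ft := P *m F *m Q^t*%sesqui.
pose Y := P^t*%sesqui *m (\matrix_(i, j) ((\sum_(n < l) p n (al i) *
      \sum_(m < N) q n m * f (sg m + be j))%:C * Ft i j)) *m Q.
have rY : (\rank Y <= l * k)%N.
  apply: (leq_trans (mxrankM_maxl _ _)); apply: (leq_trans (mxrankM_maxr _ _)).
  apply: (@low_rank_multiplier R n l k Ft (fun m i => p m (al i))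
    (fun n j => \sum_(m < N) q n m * f (sg m + be j))).
  rewrite -hrank; apply: (leq_trans (mxrankM_maxl _ _)); exact: mxrankM_maxr.
have XY : X - Y = P^t*%sesqui *m (\matrix_(i, j) ((f (al i + be j) - \sum_(n < l) p n (al i) *
      \sum_(m < N) q n m * f (sg m + be j))%:C * Ft i j)) *m Q.
  by rewrite XE /Y -mulmxBl -mulmxBr multiplierB.
have fa := laplace_ge0 Hmu ha.
have sig : sigma (1 + l * k) X <= g * rh * f a * norm2 F.
  apply: (sigma_le_of_low_rank _ rY) => [|v].
    by rewrite mulr_ge0 ?norm2_ge0// mulr_ge0.
  rewrite XY; apply: (multiplier_error_bound F Hmu ha T0 uP uQ) => //.
  - by move=> i; have /andP[h _] := al_ab i; exact: lt_le_trans h.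
  - by move=> j; have /andP[] := be_ab j.
  - by move=> i t t0; apply: approx.
have g0 : 0 <= g.
  by rewrite mulr_ge0// gammac_ge0// ler_pdivlMr// mul1r ltW.
apply: (@le_trans _ _ (g%:E * (f a)%:E * (rh * norm2 F)%:E)%E).
  by rewrite -!EFinM lee_fin (le_trans sig)// le_eqVlt; apply/orP; left; apply/eqP; ring.
apply: lee_wpmul2r; first by rewrite lee_fin mulr_ge0 ?norm2_ge0.
apply: lee_wpmul2l; first by rewrite lee_fin.
exact: (laplace_le_limit0p Hmu ha).
Qed.
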